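(* Let $H$ be a Hopf algebra over a field $k$. If $H$ is commutative or pointed cocommutative, then the algebra $S(t_H)_{\Theta}$ is a free $\mathcal{B}_H$-module.
   Context: $k$ is a field; algebras are associative unital $k$-algebras, coalgebras are coassociative counital $k$-coalgebras, and $\otimes=\otimes_k$. Sweedler notation without summation sign: $\Delta(x)=x_1\otimes x_2$, $\Delta^{(2)}(x)=x_1\otimes x_2\otimes x_3$, etc.; $\varepsilon$ is the counit. Let $H$ be a Hopf algebra over $k$. Let $t_H$ be a copy of the underlying vector space of $H$, with identity map $H\to t_H$ written $x\mapsto t_x$, and let $S(t_H)$ be the symmetric algebra of $t_H$. There is a unique linear map $x\mapsto t^{-1}_x$ from $H$ to the field of fractions $\mathrm{Frac}\,S(t_H)$ such that $t_{x_1}t^{-1}_{x_2}=t^{-1}_{x_1}t_{x_2}=\varepsilon(x)1$ for all $x\in H$. $S(t_H)_\Theta$ denotes the subalgebra of $\mathrm{Frac}\,S(t_H)$ generated by all $t_x$ and $t_x^{-1}$ ($x\in H$). For $x,y\in H$ put $\sigma(x,y)=t_{x_1}t_{y_1}t^{-1}_{x_2y_2}$ and $\sigma^{-1}(x,y)=t_{x_1y_1}t^{-1}_{x_2}t^{-1}_{y_2}$ in $S(t_H)_\Theta$. $\mathcal{B}_H$ denotes the subalgebra of $S(t_H)_\Theta$ generated by all $\sigma(x,y)$ and $\sigma^{-1}(x,y)$, $x,y\in H$; $S(t_H)_\Theta$ is regarded as a $\mathcal{B}_H$-module by multiplication. *)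

(* Defs.v *)
From HB Require Import structures.
From mathcomp Require Import all_boot all_algebra.
From mathcomp Require Import boolp classical_sets.

Set Implicit Arguments.
Unset Strict Implicit.
Unset Printing Implicit Defensive.

Import GRing.Theory.
Local Open Scope ring_scope.
Local Open Scope classical_set_scope.
Local Open Scope quotient_scope.

(* [tensor V W] is the set of finite formal sums of pairs
   modulo the congruence generated by the usual relations. *)
Section TensorProduct.
Variables (k : fieldType) (V W : lmodType k).

Inductive tensor_eq : seq (V * W) -> seq (V * W) -> Prop :=
| TensorRefl s : tensor_eq s s
| TensorSym s s' : tensor_eq s s' -> tensor_eq s' s
| TensorTrans s s' s'' : tensor_eq s s' -> tensor_eq s' s'' -> tensor_eq s s''
| TensorCat s1 s1' s2 s2' :
    tensor_eq s1 s1' -> tensor_eq s2 s2' -> tensor_eq (s1 ++ s2) (s1' ++ s2')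
| TensorComm s1 s2 : tensor_eq (s1 ++ s2) (s2 ++ s1)
| TensorZero w : tensor_eq [:: (0, w)] [::]
| TensorAddl v v' w : tensor_eq [:: (v + v', w)] [:: (v, w); (v', w)]
| TensorAddr v w w' : tensor_eq [:: (v, w + w')] [:: (v, w); (v, w')]
| TensorScale a v w : tensor_eq [:: (a *: v, w)] [:: (v, a *: w)].

Definition tensor_eqb (s s' : seq (V * W)) : bool := `[< tensor_eq s s' >].

Lemma tensor_eqb_refl : reflexive tensor_eqb.
Proof. by move=> s; apply/asboolP; exact: TensorRefl. Qed.

Lemma tensor_eqb_sym : symmetric tensor_eqb.
Proof. by move=> s s'; apply/asboolP/asboolP; exact: TensorSym. Qed.

Lemma tensor_eqb_trans : transitive tensor_eqb.
Proof.
move=> s' s s'' /asboolP h /asboolP h'; apply/asboolP; exact: TensorTrans h h'.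
Qed.

Canonical tensor_equiv :=
  EquivRel tensor_eqb tensor_eqb_refl tensor_eqb_sym tensor_eqb_trans.

Definition tensor : Type := {eq_quot tensor_equiv}.

HB.instance Definition _ := Choice.on tensor.
HB.instance Definition _ := EqQuotient.on tensor.

Lemma tensorP (s s' : seq (V * W)) :
  tensor_eq s s' <-> \pi_tensor s = \pi_tensor s'.
Proof.
split=> [h|/eqP h]; first by apply/eqP; rewrite eqmodE; apply/asboolP.
by move: h; rewrite eqmodE => /asboolP.
Qed.

Definition tensor_add (x y : tensor) : tensor := \pi_tensor (repr x ++ repr y).

Definition tensor_scale (a : k) (x : tensor) : tensor :=
  \pi_tensor [seq (a *: p.1, p.2) | p <- repr x].

Lemma tensor_eq_map a s s' : tensor_eq s s' ->
  tensor_eq [seq (a *: p.1, p.2) | p <- s] [seq (a *: p.1, p.2) | p <- s'].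
Proof.
elim=> {s s'} /=.
- by move=> s; exact: TensorRefl.
- by move=> s s' _; exact: TensorSym.
- by move=> s s' s'' _ h _; exact: TensorTrans h.
- by move=> *; rewrite !map_cat; exact: TensorCat.
- by move=> *; rewrite !map_cat; exact: TensorComm.
- by move=> w; rewrite scaler0; exact: TensorZero.
- by move=> v v' w; rewrite scalerDr; exact: TensorAddl.
- by move=> v w w'; exact: TensorAddr.
- by move=> b v w; rewrite scalerA mulrC -scalerA; exact: TensorScale.
Qed.

Lemma tensor_addE s s' :
  tensor_add (\pi_tensor s) (\pi_tensor s') = \pi_tensor (s ++ s').
Proof. by apply/tensorP; apply: TensorCat; apply/tensorP; rewrite reprK. Qed.

Lemma tensor_scaleE a s : tensor_scale a (\pi_tensor s) =
  \pi_tensor [seq (a *: p.1, p.2) | p <- s].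
Proof. by apply/tensorP; apply: tensor_eq_map; apply/tensorP; rewrite reprK. Qed.

Lemma tensor_ind (P : tensor -> Prop) :
  (forall s, P (\pi_tensor s)) -> forall x, P x.
Proof. by move=> h x; rewrite -(reprK x). Qed.

Lemma tensor_addA : associative tensor_add.
Proof.
by do 3![elim/tensor_ind=> ?]; rewrite !tensor_addE catA.
Qed.

Lemma tensor_addC : commutative tensor_add.
Proof.
by do 2![elim/tensor_ind=> ?]; rewrite !tensor_addE; apply/tensorP/TensorComm.
Qed.

Lemma tensor_add0 : left_id (\pi_tensor [::]) tensor_add.
Proof. by elim/tensor_ind=> s; rewrite tensor_addE. Qed.

Lemma tensor_addN : left_inverse (\pi_tensor [::]) (tensor_scale (-1)) tensor_add.
Proof.
elim/tensor_ind=> s; rewrite tensor_scaleE tensor_addE; apply/tensorP.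
elim: s => [|[v w] s IHs] /=; first exact: TensorRefl.
set s1 := [seq _ | p <- s] in IHs *.
apply: (@TensorTrans _ ([:: (-1 *: v, w); (v, w)] ++ (s1 ++ s))).
  apply: (@TensorCat [:: _] [:: _] _ ([:: (v, w)] ++ (s1 ++ s)));
    first exact: TensorRefl.
  rewrite catA -[(v, w) :: s]/([:: (v, w)] ++ s) catA.
  by apply: TensorCat (TensorRefl _); exact: TensorComm.
apply: (@TensorCat _ [::] _ [::]) IHs.
apply: TensorTrans (TensorSym (TensorAddl _ _ _)) _.
by rewrite scaleN1r addNr; exact: TensorZero.
Qed.

HB.instance Definition _ := GRing.isZmodule.Build tensor
  tensor_addA tensor_addC tensor_add0 tensor_addN.

Lemma tensor_scaleA a b x :
  tensor_scale a (tensor_scale b x) = tensor_scale (a * b) x.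
Proof.
elim/tensor_ind: x => s; rewrite !tensor_scaleE -map_comp.
by congr (\pi_tensor _); apply: eq_map => p /=; rewrite scalerA.
Qed.

Lemma tensor_scale1 : left_id 1 tensor_scale.
Proof.
elim/tensor_ind=> s; rewrite tensor_scaleE; congr (\pi_tensor _).
by rewrite -[RHS]map_id; apply: eq_map => -[v w] /=; rewrite scale1r.
Qed.

Lemma tensor_scaleDr : right_distributive tensor_scale +%R.
Proof.
move=> a; do 2![elim/tensor_ind=> ?].
by rewrite /GRing.add /= !(tensor_addE, tensor_scaleE) map_cat.
Qed.

Lemma tensor_scaleDl x : {morph tensor_scale^~ x : a b / a + b}.
Proof.
move=> a b /=; elim/tensor_ind: x => s.
rewrite [in RHS]/GRing.add /= !(tensor_addE, tensor_scaleE); apply/tensorP.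
elim: s => [|[v w] s IHs] /=; first exact: TensorRefl.
rewrite scalerDl.
set sa := [seq (a *: p.1, p.2) | p <- s] in IHs *.
set sb := [seq (b *: p.1, p.2) | p <- s] in IHs *.
apply: (@TensorTrans _ ([:: (a *: v, w); (b *: v, w)] ++ (sa ++ sb))).
  exact: (TensorCat (TensorAddl _ _ _) IHs).
apply: (TensorCat (TensorRefl [:: (a *: v, w)])).
rewrite -[(b *: v, w) :: sb]/([:: (b *: v, w)] ++ sb) -cat1s !catA.
by apply: TensorCat (TensorRefl _); exact: TensorComm.
Qed.

HB.instance Definition _ := GRing.Zmodule_isLmodule.Build k tensor
  tensor_scaleA tensor_scale1 tensor_scaleDr tensor_scaleDl.

Definition pure_tensor (v : V) (w : W) : tensor := \pi_tensor [:: (v, w)].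

(* The linear map [tensor V W -> X] induced by a bilinear map [f]; the value is
   meaningful only for bilinear [f], see [tensor_lift_pure]. *)
Definition tensor_lift (X : lmodType k) (f : V -> W -> X) (z : tensor) : X :=
  \sum_(p <- repr z) f p.1 p.2.

Definition is_bilinear (X : lmodType k) (f : V -> W -> X) : Prop :=
  (forall w, linear (f^~ w)) /\ (forall v, linear (f v)).

Section Lift.
Variables (X : lmodType k) (f : V -> W -> X) (bf : is_bilinear f).

Lemma tensor_eq_lift s s' : tensor_eq s s' ->
  \sum_(p <- s) f p.1 p.2 = \sum_(p <- s') f p.1 p.2.
Proof.
have [fl fr] := bf.
have fDl v v' w : f (v + v') w = f v w + f v' w.
  by have := fl w 1 v v'; rewrite !scale1r.
have fDr v w w' : f v (w + w') = f v w + f v w'.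
  by have := fr v 1 w w'; rewrite !scale1r.
have f0l w : f 0 w = 0 by apply: (addrI (f 0 w)); rewrite -fDl !addr0.
have f0r v : f v 0 = 0 by apply: (addrI (f v 0)); rewrite -fDr !addr0.
elim=> {s s'} //.
- by move=> s s' s'' _ -> _ ->.
- by move=> s1 s1' s2 s2' _ h1 _ h2; rewrite !big_cat /= h1 h2.
- by move=> s1 s2; rewrite !big_cat /= addrC.
- by move=> w; rewrite !(big_cons, big_nil) /= f0l addr0.
- by move=> v v' w; rewrite !(big_cons, big_nil) /= !addr0 fDl.
- by move=> v w w'; rewrite !(big_cons, big_nil) /= !addr0 fDr.
- move=> a v w; rewrite !big_seq1 /=.
  by have := fl w a v 0; have := fr v a w 0; rewrite !addr0 f0l f0r !addr0 => -> ->.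
Qed.

Lemma tensor_lift_pi s :
  tensor_lift f (\pi_tensor s) = \sum_(p <- s) f p.1 p.2.
Proof. by apply: tensor_eq_lift; apply/tensorP; rewrite reprK. Qed.

Lemma tensor_lift_pure v w : tensor_lift f (pure_tensor v w) = f v w.
Proof. by rewrite tensor_lift_pi big_seq1. Qed.

Lemma tensor_lift_linear : linear (tensor_lift f).
Proof.
move=> a x y; elim/tensor_ind: x => s; elim/tensor_ind: y => s'.
rewrite [a *: _]tensor_scaleE [_ + _]tensor_addE !tensor_lift_pi big_cat /=.
congr (_ + _); rewrite big_map scaler_sumr; apply: eq_bigr => p _ /=.
have [fl _] := bf; have := fl p.2 a p.1 0; rewrite !addr0 => ->.
have /(_ 1 0 0) := fl p.2; rewrite !scale1r addr0 => h.
by rewrite -[X in _ + X = _](addrK (f 0 p.2)) -h subrr addr0.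
Qed.

End Lift.

Lemma pure_tensor_bilinear : is_bilinear pure_tensor.
Proof.
split=> [w|v] a x y; rewrite [in RHS]/GRing.scale [in RHS]/GRing.add /=
  tensor_scaleE tensor_addE.
  by apply/tensorP; exact: TensorAddl.
apply/tensorP; apply: TensorTrans (TensorAddr _ _ _) _.
rewrite -cat1s -[X in tensor_eq _ X]cat1s; apply: TensorCat (TensorRefl _).
exact/TensorSym/TensorScale.
Qed.

Lemma tensor_sum_pure (z : tensor) :
  z = \sum_(p <- repr z) pure_tensor p.1 p.2.
Proof.
rewrite -[LHS]reprK; elim: (repr z) => [|[v w] s IHs]; first by rewrite big_nil.
by rewrite big_cons -IHs [RHS]tensor_addE.
Qed.

End TensorProduct.

Notation "v ⊗ w" := (pure_tensor v w) (at level 40, left associativity) : ring_scope.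

Definition tensor_map (k : fieldType) (V W V' W' : lmodType k)
    (f : V -> V') (g : W -> W') : tensor V W -> tensor V' W' :=
  tensor_lift (fun v w => f v ⊗ g w).

Definition tensor_assoc (k : fieldType) (U V W : lmodType k) :
    tensor (tensor U V) W -> tensor U (tensor V W) :=
  tensor_lift (fun z w => tensor_lift (fun u v => u ⊗ (v ⊗ w)) z).

Definition tensor_swap (k : fieldType) (V W : lmodType k) : tensor V W -> tensor W V :=
  tensor_lift (fun v w => w ⊗ v).

Definition tensor_mul (k : fieldType) (A : algType k) (z z' : tensor A A) : tensor A A :=
  tensor_lift (fun x y => tensor_lift (fun x' y' => (x * x') ⊗ (y * y')) z') z.

Record hopfAlgebra (k : fieldType) := HopfAlgebra {
  hopf_alg :> algType k;
  comul : {linear hopf_alg -> tensor hopf_alg hopf_alg};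
  counit : {linear hopf_alg -> k^o};
  antipode : {linear hopf_alg -> hopf_alg};
  comulA : forall x, tensor_assoc (tensor_map comul idfun (comul x)) =
                     tensor_map idfun comul (comul x);
  counitl : forall x, tensor_lift (fun x1 x2 => (counit x1 : k) *: x2) (comul x) = x;
  counitr : forall x, tensor_lift (fun x1 x2 => (counit x2 : k) *: x1) (comul x) = x;
  comul1 : comul 1 = 1 ⊗ 1;
  comulM : forall x y, comul (x * y) = tensor_mul (comul x) (comul y);
  counit1 : counit 1 = 1;
  counitM : forall x y, counit (x * y) = counit x * counit y;
  antipodel : forall x,
    tensor_lift (fun x1 x2 => antipode x1 * x2) (comul x) = (counit x : k)%:A;
  antipoder : forall x,
    tensor_lift (fun x1 x2 => x1 * antipode x2) (comul x) = (counit x : k)%:A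
}.

Section Coalgebra.
Variables (k : fieldType) (H : hopfAlgebra k).

(* [sweedler x f] is [f x_1 x_2] in Sweedler notation, for bilinear [f]. *)
Definition sweedler (X : lmodType k) (x : H) (f : H -> H -> X) : X :=
  tensor_lift f (comul H x).

Definition cocommutative : Prop :=
  forall x : H, tensor_swap (comul H x) = comul H x.

Definition is_subspace (D : set H) : Prop :=
  D 0 /\ forall (a : k) (x y : H), D x -> D y -> D (a *: x + y).

Definition is_subcoalgebra (D : set H) : Prop :=
  is_subspace D /\ forall x, D x -> exists s : seq (H * H),
    (forall p, p \in s -> D p.1 /\ D p.2) /\
    comul H x = \sum_(p <- s) p.1 ⊗ p.2.

Definition is_simple_subcoalgebra (D : set H) : Prop :=
  [/\ is_subcoalgebra D, D <> [set 0] &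
      forall E : set H, is_subcoalgebra E -> E `<=` D -> E = [set 0] \/ E = D].

Definition one_dimensional (D : set H) : Prop :=
  exists d : H, d <> 0 /\ D = [set a *: d | a in [set: k]].

Definition pointed : Prop :=
  forall D : set H, is_simple_subcoalgebra D -> one_dimensional D.

End Coalgebra.

Definition is_symmetric_algebra (k : fieldType) (V : lmodType k)
    (T : comAlgType k) (t : {linear V -> T}) : Prop :=
  forall (A : comAlgType k) (f : {linear V -> A}),
    exists g : {lrmorphism T -> A}, (forall v, g (t v) = f v) /\
      forall g' : {lrmorphism T -> A}, (forall v, g' (t v) = f v) -> g' =1 g.

#[short(type="fieldAlgType")]
HB.structure Definition FieldAlgebra (k : fieldType) :=
  {F of GRing.Field F & GRing.ComAlgebra k F}.

Definition is_field_of_fractions (k : fieldType) (T : comAlgType k)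
    (F : fieldAlgType k) (phi : {lrmorphism T -> F}) : Prop :=
  injective phi /\
  forall z : F, exists a b : T, b <> 0 /\ z = phi a / phi b.

Definition is_subalgebra (k : fieldType) (A : algType k) (B : set A) : Prop :=
  [/\ B 1, forall (a : k) x y, B x -> B y -> B (a *: x + y)
    & forall x y, B x -> B y -> B (x * y)].

Definition generated_subalgebra (k : fieldType) (A : algType k) (G : set A) :
    set A :=
  smallest (@is_subalgebra k A) G.

(* [B] is meant to be a subring of [A] and [M] a [B]-submodule of [A]. *)
Definition is_free_module (A : comNzRingType) (B M : set A) : Prop :=
  exists (I : choiceType) (e : I -> A),
    [/\ forall i, M (e i),
        forall x, M x -> exists (s : seq I) (c : I -> A),
          (forall i, B (c i)) /\ x = \sum_(i <- s) c i * e i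
      & forall (s : seq I) (c : I -> A), uniq s -> (forall i, B (c i)) ->
          \sum_(i <- s) c i * e i = 0 -> forall i, i \in s -> c i = 0].

Section GenericCocycle.
Variables (k : fieldType) (H : hopfAlgebra k) (F : fieldAlgType k).

(* [t x] and [tinv x] are the elements $t_x$ and $t^{-1}_x$ of the fraction
   field [F]. *)
Variables (t tinv : H -> F).

Definition is_convolution_inverse : Prop := forall x : H,
  sweedler x (fun x1 x2 => t x1 * tinv x2) = (counit H x : k)%:A /\
  sweedler x (fun x1 x2 => tinv x1 * t x2) = (counit H x : k)%:A.

Definition S_Theta : set F := generated_subalgebra (range t `|` range tinv).

Definition sigma (x y : H) : F :=
  sweedler x (fun x1 x2 => sweedler y (fun y1 y2 =>
    t x1 * t y1 * tinv (x2 * y2))).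

Definition sigmainv (x y : H) : F :=
  sweedler x (fun x1 x2 => sweedler y (fun y1 y2 =>
    t (x1 * y1) * tinv x2 * tinv y2)).

Definition calB : set F := generated_subalgebra
  ([set z | exists x y, z = sigma x y] `|` [set z | exists x y, z = sigmainv x y]).

End GenericCocycle.

(* Main.v *)
Require Import Defs.
From HB Require Import structures.
From mathcomp Require Import all_boot all_algebra.
From mathcomp Require Import boolp classical_sets functions.

(** Write $A = S(t_H)_\Theta$ and $B = \mathcal{B}_H$. The identity
    $t_x t_y = \sigma(x_1, y_1) t_{x_2 y_2}$, together with a similar expression for
    $t^{-1}_z$ that uses the antipode of $H$, shows that the elements $t_x$ span $A$
    over $B$ ([cocycle_alg_span]). A basis is then selected among the $t_x$ by Zorn's
    lemma, by climbing a tower of subspaces $D$ of $H$ that grows by one vector $x$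
    at a time ([free_by_tower]). What makes the selection work is a dichotomy for
    each step: if $b t_x \in B t_D$ with $b \in B$, then $b = 0$ or
    $t_x \in B t_D$.

    Both cases of the theorem obtain the dichotomy from algebra maps out of $A$,
    which exist because $A$ is the free commutative algebra on a
    convolution-invertible linear map out of $H$ ([extension]): an element
    $t^{-1}_x$ is a fraction whose denominator is the determinant of the values of
    $t$ on the matrix coefficients of a finite-dimensional subcoalgebra containing
    $x$, and a convolution-invertible map sends this determinant to a unit.

    If $H$ is commutative, every subspace $D$ is allowed. The algebra map
    $t_x \mapsto t_{x_1} \otimes x_2$ from $A$ to $A \otimes H$ restricts to
    $b \mapsto b \otimes 1$ on $B$, and multiplying back by $t^{-1}$ sends $b t_x$ to
    $b \otimes x$. Hence linearly independent vectors of $H$ give elements independent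
    over $B$ ([coefficient_form], [commutative_step]).

    If $H$ is cocommutative, $A$ is a Hopf algebra with $\Delta(t_x) = t_{x_1} \otimes
    t_{x_2}$ and $B$ is a Hopf subalgebra. The tower consists of right coideals
    $D$. As $H$ is pointed, some $x$ outside $D$ satisfies $\Delta(x) \in x \otimes h +
    D \otimes H$ with $h$ group-like ([pointed_step]). Then the elements $b$ of $B$ with
    $b t_x \in B t_D$ form an ideal $I$ with $\Delta(I) \subseteq I \otimes B$, and
    $1 \otimes b = b_1 S(b_2) \otimes b_3 \in I \otimes B$ for $b \in I$ forces $I = 0$ or
    $1 \in I$ ([cocommutative_step]). *)

Set Implicit Arguments.
Unset Strict Implicit.
Unset Printing Implicit Defensive.

Import GRing.Theory.
Local Open Scope ring_scope.
Local Open Scope classical_set_scope.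

(** * Linear forms and shortest expressions of tensors *)

Section LinearAlgebra.
Variable k : fieldType.
Implicit Types V W X : lmodType k.

Definition linear_of V X (f : V -> X) (fl : linear f) : {linear V -> X} :=
  HB.pack f (GRing.isLinear.Build k V X _ f fl).

Definition subspace V (D : set V) : Prop :=
  D 0 /\ forall (a : k) x y, D x -> D y -> D (a *: x + y).

Lemma linear_linear V X (f : {linear V -> X}) : linear f.
Proof. by move=> a x y; rewrite linearP. Qed.

Lemma subspaceZ V (D : set V) a x : subspace D -> D x -> D (a *: x).
Proof. by case=> D0 DL Dx; rewrite -[a *: x]addr0; exact: DL. Qed.

Lemma subspaceD V (D : set V) x y : subspace D -> D x -> D y -> D (x + y).
Proof. by case=> D0 DL Dx Dy; rewrite -[x]scale1r; exact: DL. Qed.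

Lemma subspaceB V (D : set V) x y : subspace D -> D x -> D y -> D (x - y).
Proof. by case=> D0 DL Dx Dy; rewrite addrC -scaleN1r; exact: DL. Qed.

Lemma subspace_sum V (D : set V) (I : Type) (r : seq I) (F : I -> V) :
  subspace D -> (forall i, D (F i)) -> D (\sum_(i <- r) F i).
Proof.
move=> sD DF; elim/big_rec: _ => [|i x _ Dx]; first by case: sD.
exact: subspaceD.
Qed.

Definition span V n (e : 'I_n -> V) : set V :=
  [set x | exists a : 'I_n -> k, x = \sum_i a i *: e i].

Lemma zero_subspace V : subspace [set 0 : V].
Proof. by split=> // a x y -> ->; rewrite scaler0 addr0. Qed.

Definition adjoin V (D : set V) v : set V := [set y | exists a, D (y - a *: v)].

Lemma adjoin_sub V (D : set V) v : D `<=` adjoin D v.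
Proof. by move=> d Dd; exists 0; rewrite scale0r subr0. Qed.

Lemma adjoin_elem V (D : set V) v : D 0 -> adjoin D v v.
Proof. by exists 1; rewrite scale1r subrr. Qed.

Lemma adjoin_subspace V (D : set V) v : subspace D -> subspace (adjoin D v).
Proof.
move=> sD; split=> [|c x y [a Da] [b Db]].
  by exists 0; rewrite scale0r subr0; case: sD.
exists (c * a + b); case: sD => _ /(_ c _ _ Da Db).
by rewrite scalerBr scalerA scalerDl opprD addrACA.
Qed.

(** By Zorn's lemma take a subspace [W] containing [D] and maximal among those
    missing [v]; maximality forces [W] to be a complement of the line of [v],
    and the functional is the coordinate along [v]. *)
Lemma separation V (D : set V) v : subspace D -> ~ D v ->
  exists l : {linear V -> k^o}, (forall d, D d -> l d = 0) /\ l v = 1.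
Proof.
move=> sD Dv.
(* Joining the sets with D makes D itself the bound of the empty chain. *)
pose P := [set A : set V | subspace (D `|` A) /\ ~ (D `|` A) v].
have [F FP Ftot|A [[sA Av] Amax]] := @Zorn_bigcup V P.
  have [->|/set0P[A0 FA0]] := eqVneq F set0.
    by split; rewrite bigcup_set0 setU0.
  have UE A x : F A -> (D `|` A) x -> (D `|` \bigcup_(X in F) X) x.
    by move=> FA [Dx|Ax]; [left|right; exists A].
  split; last by case=> // -[A FA Av]; have [_] := FP _ FA; apply; right.
  split; first by left; case: sD.
  have aux x : (D `|` \bigcup_(X in F) X) x -> exists2 A, F A & (D `|` A) x.
    by case=> [Dx|[A FA Ax]]; [exists A0 => //; left|exists A => //; right].
  move=> a x y /aux[A FA Ax] /aux[B FB By].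
  have [AB|BA] := Ftot _ _ FA FB.
    apply: (UE B) => //; apply: (FP _ FB).1.2 => //.
    by case: Ax => [?|/AB ?]; [left|right].
  apply: (UE A) => //; apply: (FP _ FA).1.2 => //.
  by case: By => [?|/BA ?]; [left|right].
set W := D `|` A in sA Av.
have coordP y : exists a, W (y - a *: v).
  apply: contrapT => ny.
  pose A' := adjoin W y.
  have sA' : subspace A' := adjoin_subspace y sA.
  have WA' : W `<=` A' by exact: adjoin_sub.
  have eA' : D `|` A' = A'.
    by apply/seteqP; split=> z; [case=> // Dz; apply: WA'; left|right].
  apply: (Amax A').
    split=> [z Az|A'A]; first by apply: WA'; right.
    apply: ny; exists 0; rewrite scale0r subr0; right; apply: A'A.
    by apply: adjoin_elem; case: sA.
  split; rewrite eA' //; case=> a Wa.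
  have [a0|a0] := eqVneq a 0; first by apply: Av; move: Wa; rewrite a0 scale0r subr0.
  apply: ny; exists a^-1.
  have := subspaceZ (- a^-1) sA Wa.
  by rewrite scalerBr scalerA mulNr mulVf // !scaleNr scale1r opprK addrC.
have coord_uniq y a b : W (y - a *: v) -> W (y - b *: v) -> a = b.
  move=> Wa Wb; apply/eqP; rewrite -subr_eq0; apply/eqP.
  have := subspaceB sA Wb Wa; rewrite opprB addrC addrA subrK -scalerBl => Wab.
  apply: contrapT => /eqP ab0; apply: Av.
  by have := subspaceZ (a - b)^-1 sA Wab; rewrite scalerA mulVf // scale1r.
have [l lP] := choice coordP.
have llin : linear (l : V -> k^o).
  move=> a x y; apply: (coord_uniq (a *: x + y)); first exact: lP.
  have /= := sA.2 a _ _ (lP x) (lP y).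
  by rewrite scalerBr scalerA addrACA -opprD -scalerDl.
exists (linear_of llin); split=> /= [d Dd|].
  by apply: (coord_uniq d); [exact: lP|rewrite scale0r subr0; left].
by apply: (coord_uniq v); [exact: lP|rewrite scale1r subrr; case: sA].
Qed.

Lemma pure_linl V W (w : W) : linear (fun v : V => v ⊗ w).
Proof. exact: (pure_tensor_bilinear V W).1. Qed.
Lemma pure_linr V W (v : V) : linear (fun w : W => v ⊗ w).
Proof. exact: (pure_tensor_bilinear V W).2. Qed.

HB.instance Definition _ V W (v : V) :=
  GRing.isLinear.Build k W (tensor V W) _ (pure_tensor v) (pure_linr v).

Lemma pureDl V W (v v' : V) (w : W) : (v + v') ⊗ w = v ⊗ w + v' ⊗ w.
Proof. by have := pure_linl w 1 v v'; rewrite !scale1r. Qed.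

Lemma pureDr V W (v : V) (w w' : W) : v ⊗ (w + w') = v ⊗ w + v ⊗ w'.
Proof. exact: linearD. Qed.

Lemma pure0l V W (w : W) : (0 : V) ⊗ w = 0.
Proof. by apply: (addrI (0 ⊗ w)); rewrite -pureDl !addr0. Qed.

Lemma pureZl V W a (v : V) (w : W) : (a *: v) ⊗ w = a *: (v ⊗ w).
Proof. by have := pure_linl w a v 0; rewrite pure0l !addr0. Qed.

Lemma pureZr V W a (v : V) (w : W) : v ⊗ (a *: w) = a *: (v ⊗ w).
Proof. exact: linearZ. Qed.

Lemma pure_suml V W I (r : seq I) (P : pred I) (F : I -> V) (w : W) :
  (\sum_(i <- r | P i) F i) ⊗ w = \sum_(i <- r | P i) F i ⊗ w.
Proof. by elim/big_rec2: _ => [|i x y _ <-]; rewrite ?pure0l ?pureDl. Qed.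

Lemma pure_sumr V W I (r : seq I) (P : pred I) (v : V) (F : I -> W) :
  v ⊗ (\sum_(i <- r | P i) F i) = \sum_(i <- r | P i) v ⊗ F i.
Proof. exact: linear_sum. Qed.

Lemma tensor_linear_ext V W X (f g : tensor V W -> X) :
  linear f -> linear g -> (forall v w, f (v ⊗ w) = g (v ⊗ w)) -> f =1 g.
Proof.
move=> fl gl fg z; rewrite (tensor_sum_pure z).
rewrite -[LHS]/(linear_of fl _) -[RHS]/(linear_of gl _) !linear_sum.
by apply: eq_bigr => p _; exact: fg.
Qed.

Definition dual_families V n (u : 'I_n -> V) (f : 'I_n -> {linear V -> k^o}) :=
  forall i j, f i (u j) = (i == j)%:R.

Lemma dual_families_exist V n (u : 'I_n -> V) :
  (forall (a : 'I_n -> k) i, a i = 0 -> u i <> \sum_j a j *: u j) ->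
  exists f, dual_families u f.
Proof.
move=> uindep.
pose D i := [set x | exists2 a : 'I_n -> k, a i = 0 & x = \sum_j a j *: u j].
have sD i : subspace (D i).
  split=> [|c x y [a a0 ->] [b b0 ->]].
    by exists (fun=> 0) => //; rewrite big1 // => j _; rewrite scale0r.
  exists (fun i => c * a i + b i); first by rewrite a0 b0 mulr0 addr0.
  rewrite scaler_sumr -big_split.
  by apply: eq_bigr => j _; rewrite scalerDl scalerA.
have [|f fP] := choice (P := fun i (l : {linear V -> k^o}) =>
  (forall d, D i d -> l d = 0) /\ l (u i) = 1).
  move=> i; apply: separation => // -[a a0 ua]; exact: (uindep a i).
exists f => i j; have [<-|ij] := eqVneq i j; first exact: (fP i).2.
apply: (fP i).1; exists (fun l => (l == j)%:R); first by rewrite (negPf ij).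
rewrite (bigD1 j) //= eqxx scale1r big1 ?addr0 // => l /negPf ->.
by rewrite scale0r.
Qed.

(** An expression of minimal length has both families of factors linearly
    independent, since a linear dependency on either side would let two terms be
    merged. *)
Lemma tensor_minimal_expression V W (U : set V) (U' : set W) (s : seq (V * W)) :
  subspace U -> subspace U' -> (forall p, p \in s -> U p.1 /\ U' p.2) ->
  exists n (u : 'I_n -> V) (v : 'I_n -> W) f g,
    [/\ forall i, U (u i) /\ U' (v i),
        \sum_(p <- s) p.1 ⊗ p.2 = \sum_i u i ⊗ v i,
        dual_families u f & dual_families v g].
Proof.
move=> sU sU' sUU'; set z := \sum_(p <- s) _.
pose Q n := `[< exists (u : 'I_n -> V) (v : 'I_n -> W),
  (forall i, U (u i) /\ U' (v i)) /\ z = \sum_i u i ⊗ v i >].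
have exQ : exists n, Q n.
  exists (size s); apply/asboolP.
  exists (fun i => (tnth (in_tuple s) i).1), (fun i => (tnth (in_tuple s) i).2).
  by split=> [i|]; [exact/sUU'/mem_tnth|rewrite /z big_tnth].
have [n /asboolP[u [v [uvU zE]]] nmin] := ex_minnP exQ.
have {}nmin m : Q m -> (m < n)%N -> False by move=> /nmin; rewrite leqNgt => /negP.
exists n, u, v.
have [f fP] : exists f, dual_families u f.
  apply: dual_families_exist => a i ai0 ui.
  case: n => [|n] in u v uvU zE nmin a i ai0 ui *; first by have := ltn_ord i.
  apply: (nmin n) => //; apply/asboolP.
  exists (fun j => u (lift i j)), (fun j => v (lift i j) + a (lift i j) *: v i).
  split=> [j|].
    split; first exact: (uvU _).1.
    exact: subspaceD sU' (uvU _).2 (subspaceZ _ sU' (uvU _).2).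
  rewrite zE (bigD1_ord i) //= {1}ui (bigD1_ord i) //= ai0 scale0r add0r.
  rewrite pure_suml -big_split; apply: eq_bigr => j _ /=.
  by rewrite pureDr pureZr pureZl addrC.
have [g gP] : exists g, dual_families v g.
  apply: dual_families_exist => a i ai0 vi.
  case: n => [|n] in u v f fP uvU zE nmin a i ai0 vi *; first by have := ltn_ord i.
  apply: (nmin n) => //; apply/asboolP.
  exists (fun j => u (lift i j) + a (lift i j) *: u i), (fun j => v (lift i j)).
  split=> [j|].
    split; last exact: (uvU _).2.
    exact: subspaceD sU (uvU _).1 (subspaceZ _ sU (uvU _).1).
  rewrite zE (bigD1_ord i) //= {1}vi (bigD1_ord i) //= ai0 scale0r add0r.
  rewrite pure_sumr -big_split; apply: eq_bigr => j _ /=.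
  by rewrite pureDl pureZr pureZl addrC.
by exists f, g.
Qed.

End LinearAlgebra.

(** * The tensor product of two commutative algebras *)

Section TensorLift.
Variables (k : fieldType) (V W X : lmodType k).

Lemma bilinear_of (f : V -> W -> X) :
  (forall a v v' w, f (a *: v + v') w = a *: f v w + f v' w) ->
  (forall a v w w', f v (a *: w + w') = a *: f v w + f v w') -> is_bilinear f.
Proof. by move=> fl fr; split=> ? a x y; [exact: fl|exact: fr]. Qed.

Lemma lift_sum (f : V -> W -> X) I (r : seq I) (v : I -> V) (w : I -> W) :
  is_bilinear f ->
  tensor_lift f (\sum_(i <- r) v i ⊗ w i) = \sum_(i <- r) f (v i) (w i).
Proof.
move=> bf; rewrite -[LHS]/(linear_of (tensor_lift_linear bf) _) linear_sum.
apply: eq_bigr => i _.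
exact: tensor_lift_pure.
Qed.

End TensorLift.

Section TensorAlgebra.
Variables (k : fieldType) (A C : comAlgType k).
Local Notation T := (tensor A C).

Let mulf (x : A) (y : C) : T -> T :=
  tensor_lift (fun x' y' => (x * x') ⊗ (y * y')).

Let mulf_bilinear x y :
  is_bilinear (fun (x' : A) (y' : C) => (x * x') ⊗ (y * y')).
Proof.
by apply: bilinear_of => a u v w;
  rewrite mulrDr -scalerAr ?pureDl ?pureDr ?pureZl ?pureZr.
Qed.

Let mulf_lin x y : linear (mulf x y).
Proof. exact: tensor_lift_linear. Qed.

Let mulfE x y x' y' : mulf x y (x' ⊗ y') = (x * x') ⊗ (y * y').
Proof. exact: tensor_lift_pure. Qed.

Let mulf_linl z y : linear (fun x => mulf x y z).
Proof.
move=> a x x'; rewrite /mulf (tensor_sum_pure z) !lift_sum //.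
rewrite scaler_sumr -big_split; apply: eq_bigr => p _.
by rewrite mulrDl -scalerAl pureDl pureZl.
Qed.

Let mulf_linr z x : linear (fun y => mulf x y z).
Proof.
move=> a y y'; rewrite /mulf (tensor_sum_pure z) !lift_sum //.
rewrite scaler_sumr -big_split; apply: eq_bigr => p _.
by rewrite mulrDl -scalerAl pureDr pureZr.
Qed.

Definition talg_mul (z z' : T) : T := tensor_lift (fun x y => mulf x y z') z.

Let mulf_bil z : is_bilinear (fun x y => mulf x y z).
Proof. by split=> ?; [exact: mulf_linl|exact: mulf_linr]. Qed.

Let mul_pure x y x' y' :
  talg_mul (x ⊗ y) (x' ⊗ y') = (x * x') ⊗ (y * y').
Proof. by rewrite /talg_mul tensor_lift_pure. Qed.

Let mul_linl z : linear (talg_mul^~ z).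
Proof. exact: tensor_lift_linear. Qed.

Let mul_linr z : linear (talg_mul z).
Proof.
move=> a u v; rewrite /talg_mul (tensor_sum_pure z) !lift_sum //.
by rewrite scaler_sumr -big_split; apply: eq_bigr => p _; exact: mulf_lin.
Qed.

Let comp_lin (U U' U'' : lmodType k) (f : U' -> U'') (g : U -> U') :
  linear f -> linear g -> linear (fun x => f (g x)).
Proof. by move=> fl gl a x y; rewrite gl fl. Qed.

Let mulC : commutative talg_mul.
Proof.
move=> x y; apply: (tensor_linear_ext (mul_linl y) (mul_linr y)) => u v.
apply: (tensor_linear_ext (mul_linr (u ⊗ v)) (mul_linl (u ⊗ v))) => u' v'.
by rewrite !mul_pure mulrC [v * _]mulrC.
Qed.

Let mulA : associative talg_mul.
Proof.
move=> x y z.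
apply: (tensor_linear_ext (mul_linl (talg_mul y z))
          (comp_lin (mul_linl z) (mul_linl y))) => u v.
apply: (tensor_linear_ext (comp_lin (mul_linr (u ⊗ v)) (mul_linl z))
          (comp_lin (mul_linl z) (mul_linr (u ⊗ v)))) => u' v'.
apply: (tensor_linear_ext (comp_lin (mul_linr (u ⊗ v)) (mul_linr (u' ⊗ v')))
          (mul_linr (talg_mul (u ⊗ v) (u' ⊗ v')))) => u'' v''.
by rewrite !mul_pure !mulrA.
Qed.

Let mul1 : left_id (1 ⊗ 1) talg_mul.
Proof.
move=> x; apply: (tensor_linear_ext (mul_linr _) (fun a u v => erefl)) => u v.
by rewrite mul_pure !mul1r.
Qed.

Let mulDl : left_distributive talg_mul +%R.
Proof. by move=> x y z; have := mul_linl z 1 x y; rewrite !scale1r. Qed.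

Let one_neq0 : (1 : A) ⊗ (1 : C) != 0.
Proof.
have [|l [_ l1]] := separation (v := 1) (zero_subspace A); first exact/eqP/oner_neq0.
have bl : is_bilinear (fun (x : A) (y : C) => (l x : k) *: y).
  apply: bilinear_of => a x y z; first by rewrite linearP scalerDl scalerA.
  by rewrite scalerDr !scalerA mulrC.
apply/eqP => e0; have := tensor_lift_pure bl 1 1; rewrite e0 l1 scale1r.
rewrite -[0](pure0l _ 1) tensor_lift_pure // linear0 scale0r => /esym/eqP.
by rewrite oner_eq0.
Qed.

HB.instance Definition _ :=
  GRing.Zmodule_isComNzRing.Build T mulA mulC mul1 mulDl one_neq0.

Let scaleAl (a : k) (x y : T) : a *: (x * y) = a *: x * y.
Proof.
have : (a *: x + 0) * y = a *: (x * y) + 0 * y := mul_linl y a x 0.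
by rewrite mul0r !addr0.
Qed.

HB.instance Definition _ := GRing.Lmodule_isLalgebra.Build k T scaleAl.
HB.instance Definition _ := GRing.Lalgebra_isComAlgebra.Build k T.

Lemma pureM (x x' : A) (y y' : C) : (x ⊗ y) * (x' ⊗ y') = (x * x') ⊗ (y * y').
Proof. exact: mul_pure. Qed.

Lemma pure11 : (1 : A) ⊗ (1 : C) = 1. Proof. by []. Qed.

Fact inl_linear : linear (fun x : A => x ⊗ (1 : C)).
Proof. exact: pure_linl. Qed.
Fact inl_monoid : monoid_morphism (fun x : A => x ⊗ (1 : C)).
Proof. by split=> // x y; rewrite pureM mulr1. Qed.
Fact inr_monoid : monoid_morphism (pure_tensor (1 : A) : C -> T).
Proof. by split=> // x y; rewrite pureM mulr1. Qed.

Definition tinl (x : A) : T := x ⊗ 1.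
Definition tinr (y : C) : T := 1 ⊗ y.
HB.instance Definition _ := GRing.isLinear.Build k A T _ tinl inl_linear.
HB.instance Definition _ := GRing.isMonoidMorphism.Build A T tinl inl_monoid.
HB.instance Definition _ := GRing.isLinear.Build k C T _ tinr (pure_linr _).
HB.instance Definition _ := GRing.isMonoidMorphism.Build C T tinr inr_monoid.

End TensorAlgebra.

Arguments tinl {k A} C.
Arguments tinr {k} A {C}.

(** * Sums over the coproduct *)

Section Sweedler.
Variables (k : fieldType) (H : hopfAlgebra k).

Section Values.
Variable X : lmodType k.
Implicit Types (f : H -> H -> X) (x : H).

Lemma sweedlerE x f :
  sweedler x f = \sum_(p <- repr (comul H x)) f p.1 p.2.
Proof. by []. Qed.

Lemma eq_sweedler x f g :
  (forall a b, f a b = g a b) -> sweedler x f = sweedler x g.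
Proof. by move=> fg; apply: eq_bigr. Qed.

Lemma sweedler_linear f : is_bilinear f -> linear (fun x => sweedler x f).
Proof.
by move=> bf a x y; rewrite /sweedler linearP (tensor_lift_linear bf).
Qed.

Lemma sweedler_sum f x (I : Type) (r : seq I) (u v : I -> H) :
  is_bilinear f -> comul H x = \sum_(i <- r) u i ⊗ v i ->
  sweedler x f = \sum_(i <- r) f (u i) (v i).
Proof. by move=> bf cx; rewrite /sweedler cx lift_sum. Qed.

Lemma sweedler_comp (Y : lmodType k) (g : {linear X -> Y}) x f :
  g (sweedler x f) = sweedler x (fun a b => g (f a b)).
Proof. exact: linear_sum. Qed.

Lemma counit_sweedlerl x (g : H -> X) : linear g ->
  sweedler x (fun a b => (counit H a : k) *: g b) = g x.
Proof.
move=> gl; rewrite -[in RHS](counitl x) -[RHS]/(linear_of gl _) linear_sum.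
by apply: eq_bigr => p _; rewrite linearZ.
Qed.

Lemma counit_sweedlerr x (g : H -> X) : linear g ->
  sweedler x (fun a b => (counit H b : k) *: g a) = g x.
Proof.
move=> gl; rewrite -[in RHS](counitr x) -[RHS]/(linear_of gl _) linear_sum.
by apply: eq_bigr => p _; rewrite linearZ.
Qed.

(** Coassociativity for trilinear expressions, the form in which it enters every
    computation below: [comulA] is an equality in a triple tensor product, and the
    trilinear map is applied to both of its sides. *)
Lemma sweedler_coassoc (f : H -> H -> H -> X) x :
    (forall b c, linear (fun a => f a b c)) ->
    (forall a c, linear (fun b => f a b c)) ->
    (forall a b, linear (f a b)) ->
  sweedler x (fun y c => sweedler y (fun a b => f a b c)) =
  sweedler x (fun a y => sweedler y (fun b c => f a b c)).
Proof.
move=> f1 f2 f3.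
have bf a : is_bilinear (f a) by split.
have bL : is_bilinear (fun a z => tensor_lift (f a) z).
  split=> [z|a] c u v; last exact: (tensor_lift_linear (bf a)).
  rewrite (tensor_sum_pure z) !lift_sum // scaler_sumr -big_split.
  by apply: eq_bigr => p _; exact: f1.
have := congr1 (tensor_lift (fun a z => tensor_lift (f a) z)) (comulA x).
have bid : is_bilinear (fun u v : H => u ⊗ comul H v).
  by apply: bilinear_of => *; rewrite ?linearP ?pureDl ?pureZl.
have -> : tensor_map idfun (comul H) (comul H x) =
    \sum_(p <- repr (comul H x)) p.1 ⊗ comul H p.2 by [].
rewrite lift_sum //.
move=> e; apply: etrans e.
have -> : tensor_map (comul H) idfun (comul H x) =
    \sum_(p <- repr (comul H x)) comul H p.1 ⊗ p.2 by [].
have basc (c : H) : is_bilinear (fun u v : H => u ⊗ (v ⊗ c)).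
  by apply: bilinear_of => *; rewrite ?pureDl ?pureZl ?pureDl ?pureDr ?pureZr.
rewrite /tensor_assoc lift_sum; last first.
  split=> [c|z] a u v; first exact: (tensor_lift_linear (basc c)).
  rewrite /= (tensor_sum_pure z) !lift_sum // scaler_sumr -big_split.
  by apply: eq_bigr => p _; rewrite /= !pureDr !pureZr.
rewrite -[RHS]/(linear_of (tensor_lift_linear bL) _) linear_sum.
apply: eq_bigr => p _.
rewrite -[RHS]/(linear_of (tensor_lift_linear bL)
  (\sum_(q <- repr (comul H p.1)) q.1 ⊗ (q.2 ⊗ p.2))) linear_sum.
by apply: eq_bigr => q _; rewrite /= !tensor_lift_pure.
Qed.

End Values.

Lemma sweedler_comulM (X : lmodType k) (f : H -> H -> X) x y : is_bilinear f ->
  sweedler (x * y) f =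
  sweedler x (fun a b => sweedler y (fun c d => f (a * c) (b * d))).
Proof.
move=> bf; rewrite /sweedler comulM.
have bg (a b : H) : is_bilinear (fun c d : H => (a * c) ⊗ (b * d)).
  by apply: bilinear_of => c u v w;
    rewrite mulrDr -scalerAr ?pureDl ?pureDr ?pureZl ?pureZr.
rewrite -[LHS]/(linear_of (tensor_lift_linear bf) _) linear_sum.
apply: eq_bigr => p _.
rewrite linear_sum; apply: eq_bigr => q _ /=.
exact: tensor_lift_pure.
Qed.

Lemma sweedler1 (X : lmodType k) (f : H -> H -> X) : is_bilinear f ->
  sweedler 1 f = f 1 1.
Proof. by move=> bf; rewrite /sweedler comul1 tensor_lift_pure. Qed.

Lemma sweedler_cocomm (X : lmodType k) (f : H -> H -> X) x :
  cocommutative H -> is_bilinear f ->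
  sweedler x f = sweedler x (fun a b => f b a).
Proof.
move=> cH bf; rewrite /sweedler -{1}(cH x) /tensor_swap.
rewrite -[LHS]/(linear_of (tensor_lift_linear bf) _) linear_sum.
apply: eq_bigr => p _ /=.
exact: tensor_lift_pure.
Qed.

End Sweedler.

(** * The convolution algebra of linear maps out of a Hopf algebra *)

Section Hom.
Variables (k : fieldType) (V X : lmodType k).

Definition hom_pred : {pred V -> X} := fun f => `[< linear f >].

Record hom := Hom { hom_fun :> V -> X; homP : hom_fun \in hom_pred }.

HB.instance Definition _ := [isSub for hom_fun].
HB.instance Definition _ := [Choice of hom by <:].

Fact hom_submod_closed : submod_closed hom_pred.
Proof.
split=> [|a f g /asboolP fl /asboolP gl]; apply/asboolP => b x y.
  by rewrite /= scaler0 addr0.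
rewrite -[LHS]/(a *: f (b *: x + y) + g (b *: x + y)).
rewrite -[RHS]/(b *: (a *: f x + g x) + (a *: f y + g y)).
by rewrite fl gl !scalerDr !scalerA [b * a]mulrC addrACA.
Qed.

HB.instance Definition _ :=
  GRing.isSubmodClosed.Build k (V -> X) hom_pred hom_submod_closed.
HB.instance Definition _ := [SubChoice_isSubZmodule of hom by <:].
HB.instance Definition _ := [SubZmodule_isSubLmodule of hom by <:].

Definition hom_of (f : V -> X) (fl : linear f) : hom := Hom (asboolT fl).

Lemma homE (f g : hom) : f =1 g -> f = g.
Proof. by move=> fg; apply/val_inj/funext. Qed.

Fact hom_linear (f : hom) : linear f. Proof. exact/asboolP/homP. Qed.

HB.instance Definition _ (f : hom) :=
  GRing.isLinear.Build k V X _ (hom_fun f) (hom_linear f).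

Lemma hom_addE (f g : hom) x : (f + g) x = f x + g x. Proof. by []. Qed.
Lemma hom_scaleE a (f : hom) x : (a *: f) x = a *: f x. Proof. by []. Qed.

Lemma hom_sumE I (r : seq I) (F : I -> hom) x :
  (\sum_(i <- r) F i) x = \sum_(i <- r) F i x.
Proof. by elim/big_rec2: _ => // i y z _ <-. Qed.

End Hom.

Section Convolution.
Variables (k : fieldType) (H : hopfAlgebra k) (R : algType k).
Local Notation L := (hom H R).

Lemma conv_bilinear (f g : L) : is_bilinear (fun a b => f a * g b).
Proof.
apply: bilinear_of => a u v w; rewrite linearP ?mulrDl ?mulrDr.
  by rewrite scalerAl.
by rewrite scalerAr.
Qed.

Definition conv (f g : L) : L :=
  hom_of (sweedler_linear (conv_bilinear f g)).

Fact conv1_linear : linear (fun x : H => (counit H x : k)%:A : R).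
Proof. by move=> a x y; rewrite linearP scalerDl scalerA. Qed.
Definition conv1 : L := hom_of conv1_linear.

Fact conv_addl : left_distributive conv +%R.
Proof.
move=> f g h; apply: homE => x; rewrite hom_addE /= !sweedlerE -big_split.
by apply: eq_bigr => p _; exact: mulrDl.
Qed.

Fact conv_addr : right_distributive conv +%R.
Proof.
move=> f g h; apply: homE => x; rewrite hom_addE /= !sweedlerE -big_split.
by apply: eq_bigr => p _; exact: mulrDr.
Qed.

Fact conv_1l : left_id conv1 conv.
Proof.
move=> f; apply: homE => x; rewrite /= -[RHS]counit_sweedlerl;
  last exact: hom_linear.
by apply: eq_sweedler => a b; rewrite mulr_algl.
Qed.

Fact conv_1r : right_id conv1 conv.
Proof.
move=> f; apply: homE => x; rewrite /= -[RHS]counit_sweedlerr;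
  last exact: hom_linear.
by apply: eq_sweedler => a b; rewrite mulr_algr.
Qed.

Fact conv_assoc : associative conv.
Proof.
move=> f g h; apply: homE => x /=.
transitivity (sweedler x (fun a y => sweedler y (fun b c => f a * g b * h c))).
  apply: eq_sweedler => a y; rewrite /= !sweedlerE mulr_sumr.
  by apply: eq_bigr => p _; rewrite mulrA.
rewrite -sweedler_coassoc.
- by apply: eq_sweedler => y c; rewrite /= !sweedlerE mulr_suml.
- by move=> b c a u v; rewrite linearP !mulrDl !scalerAl.
- by move=> a c b u v; rewrite linearP mulrDr mulrDl -scalerAr -scalerAl.
- by move=> a b c u v; rewrite linearP mulrDr -scalerAr.
Qed.

Fact conv1_neq0 : conv1 != 0.
Proof.
apply/eqP => /(congr1 (fun f : L => f 1)) e; have := oner_neq0 R.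
by move: e; rewrite /= counit1 scale1r => ->; rewrite eqxx.
Qed.

HB.instance Definition _ := GRing.Zmodule_isNzRing.Build L
  conv_assoc conv_1l conv_1r conv_addl conv_addr conv1_neq0.

Fact conv_scaleAl (a : k) (f g : L) : a *: (f * g) = a *: f * g.
Proof.
apply: homE => x; rewrite hom_scaleE /= !sweedlerE scaler_sumr.
by apply: eq_bigr => p _; exact: scalerAl.
Qed.

Fact conv_scaleAr (a : k) (f g : L) : a *: (f * g) = f * (a *: g).
Proof.
apply: homE => x; rewrite hom_scaleE /= !sweedlerE scaler_sumr.
by apply: eq_bigr => p _; exact: scalerAr.
Qed.

HB.instance Definition _ := GRing.Lmodule_isLalgebra.Build k L conv_scaleAl.
HB.instance Definition _ := GRing.Lalgebra_isAlgebra.Build k L conv_scaleAr.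

Lemma convE (f g : L) x : (f * g) x = sweedler x (fun a b => f a * g b).
Proof. by []. Qed.

Lemma conv1E x : (1 : L) x = (counit H x : k)%:A.
Proof. by []. Qed.

End Convolution.

(** Swapping the two factors of the coproduct swaps the two factors of a
    convolution product. *)
Lemma conv_comm (k : fieldType) (H : hopfAlgebra k) (R : algType k) :
  cocommutative H -> commutative (@GRing.mul R) ->
  commutative (@GRing.mul (hom H R)).
Proof.
move=> cH cR f g; apply: homE => x.
rewrite !convE (sweedler_cocomm _ cH (conv_bilinear f g)).
by apply: eq_sweedler => a b; rewrite cR.
Qed.

Section PostComposition.
Variables (k : fieldType) (H : hopfAlgebra k) (R S : algType k).
Variable (g : {lrmorphism R -> S}).

Fact post_linear (f : hom H R) : linear (fun x => g (f x)).
Proof. by move=> a x y; rewrite !linearP. Qed.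
Definition post (f : hom H R) : hom H S := hom_of (post_linear f).

Lemma postE f x : post f x = g (f x). Proof. by []. Qed.

Lemma postM f f' : post (f * f') = post f * post f'.
Proof.
apply: homE => x; rewrite postE !convE sweedler_comp.
by apply: eq_sweedler => a b; rewrite rmorphM.
Qed.

Lemma post1 : post 1 = 1.
Proof. by apply: homE => x; rewrite postE !conv1E linearZ rmorph1. Qed.

End PostComposition.

(** Bilinear maps on [H] are linear maps from [H] to [hom H R], so the convolution
    product of the latter is the convolution over the coalgebra $H \otimes H$,
    computed one argument at a time. The maps [hmul],
    [hleft] and [hright] are the pullbacks along the coalgebra maps
    $x \otimes y \mapsto xy$, $x\,\varepsilon(y)$ and $\varepsilon(x)\,y$, and hence
    respect products. *)
Section Bilinear.
Variables (k : fieldType) (H : hopfAlgebra k) (R : algType k).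
Local Notation L := (hom H R).
Local Notation L2 := (hom H (hom H R)).

Definition hom2_of (f : H -> H -> R) (bf : is_bilinear f) : L2.
Proof.
apply: (@hom_of _ _ _ (fun x => hom_of (bf.2 x))) => a x y.
by apply: homE => z; exact: (bf.1 z).
Defined.

Lemma hom2E (f g : L2) : (forall x y, f x y = g x y) -> f = g.
Proof. by move=> fg; apply: homE => x; apply: homE => y. Qed.

Lemma conv2E (f g : L2) x y : (f * g) x y =
  sweedler x (fun a b => sweedler y (fun c d => f a c * g b d)).
Proof. by rewrite convE !sweedlerE hom_sumE. Qed.

Fact hmul_bilinear (f : L) : is_bilinear (fun x y => f (x * y)).
Proof.
by apply: bilinear_of => a x y z;
  rewrite ?mulrDl ?mulrDr -?scalerAl -?scalerAr linearP.
Qed.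
Definition hmul f : L2 := hom2_of (hmul_bilinear f).

Fact hleft_bilinear (f : L) :
  is_bilinear (fun x y => (counit H y : k) *: f x).
Proof.
apply: bilinear_of => a x y z; rewrite linearP.
  by rewrite scalerDr !scalerA mulrC.
by rewrite scalerDl scalerA.
Qed.
Definition hleft f : L2 := hom2_of (hleft_bilinear f).

Fact hright_bilinear (f : L) :
  is_bilinear (fun x y => (counit H x : k) *: f y).
Proof.
apply: bilinear_of => a x y z; rewrite linearP.
  by rewrite scalerDl scalerA.
by rewrite scalerDr !scalerA mulrC.
Qed.
Definition hright f : L2 := hom2_of (hright_bilinear f).

Lemma hmulM f g : hmul (f * g) = hmul f * hmul g.
Proof.
apply: hom2E => x y; rewrite conv2E /= sweedler_comulM //.
exact: conv_bilinear.
Qed.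

Lemma hmul1 : hmul 1 = 1.
Proof.
apply: hom2E => x y; by rewrite conv1E hom_scaleE /= counitM scalerA.
Qed.

Lemma hleftM f g : hleft (f * g) = hleft f * hleft g.
Proof.
apply: hom2E => x y; rewrite conv2E /= scaler_sumr.
apply: eq_bigr => p _ /=.
rewrite -[LHS](@counit_sweedlerl _ _ _ y
  (fun z => (counit H z : k) *: (f p.1 * g p.2))).
  by apply: eq_sweedler => a b; rewrite -scalerAl -scalerAr.
by move=> a u v; rewrite linearP scalerDl scalerA.
Qed.

Lemma hrightM f g : hright (f * g) = hright f * hright g.
Proof.
apply: hom2E => x y; rewrite conv2E /= [sweedler y _]sweedlerE.
rewrite -[LHS](@counit_sweedlerl _ _ _ x
  (fun z => (counit H z : k) *: (f * g) y)).
  apply: eq_sweedler => a b; rewrite scalerA convE sweedlerE scaler_sumr.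
  by apply: eq_bigr => p _; rewrite -scalerAl -scalerAr scalerA.
by move=> a u v; rewrite linearP scalerDl scalerA.
Qed.

Lemma hleft1 : hleft 1 = 1.
Proof.
by apply: hom2E => x y; rewrite conv1E hom_scaleE /= !scalerA mulrC.
Qed.

Lemma hright1 : hright 1 = 1.
Proof. by apply: hom2E => x y; rewrite conv1E hom_scaleE. Qed.

Lemma hleft_hright f g x y : (hleft f * hright g) x y = f x * g y.
Proof.
rewrite conv2E /=.
rewrite -[RHS](@counit_sweedlerr _ _ _ x (fun z => f z * g y)); last first.
  by move=> a u v; rewrite linearP mulrDl scalerAl.
apply: eq_sweedler => a b.
rewrite -[g y](@counit_sweedlerl _ _ _ y g); last exact: hom_linear.
rewrite [in RHS]sweedlerE mulr_sumr scaler_sumr; apply: eq_bigr => p _.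
by rewrite -!scalerAl -!scalerAr !scalerA mulrC.
Qed.

Lemma hright_hleft f g x y : (hright g * hleft f) x y = g y * f x.
Proof.
rewrite conv2E /=.
rewrite -[RHS](@counit_sweedlerl _ _ _ x (fun z => g y * f z)); last first.
  by move=> a u v; rewrite linearP mulrDr scalerAr.
apply: eq_sweedler => a b.
rewrite -[g y](@counit_sweedlerr _ _ _ y g); last exact: hom_linear.
rewrite [in RHS]sweedlerE mulr_suml scaler_sumr; apply: eq_bigr => p _.
by rewrite -!scalerAl -!scalerAr !scalerA mulrC.
Qed.

Lemma hleft_hrightC f g : commutative (@GRing.mul R) ->
  hleft f * hright g = hright g * hleft f.
Proof.
by move=> cR; apply: hom2E => x y; rewrite hleft_hright hright_hleft cR.
Qed.

End Bilinear.

(** * Actions of linear forms and finite-dimensional subcoalgebras *)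

Section Actions.
Variables (k : fieldType) (H : hopfAlgebra k).
Implicit Types (f g : {linear H -> k^o}) (x : H).

Fact ract_bilinear f : is_bilinear (fun a b : H => (f b : k) *: a).
Proof.
apply: bilinear_of => a u v w; first by rewrite scalerDr !scalerA mulrC.
by rewrite linearP scalerDl scalerA.
Qed.

Fact lact_bilinear f : is_bilinear (fun a b : H => (f a : k) *: b).
Proof.
apply: bilinear_of => a u v w; last by rewrite scalerDr !scalerA mulrC.
by rewrite linearP scalerDl scalerA.
Qed.

Definition ract f x : H := sweedler x (fun a b => (f b : k) *: a).
Definition lact f x : H := sweedler x (fun a b => (f a : k) *: b).

HB.instance Definition _ f := GRing.isLinear.Build k H H _ (ract f)
  (sweedler_linear (ract_bilinear f)).
HB.instance Definition _ f := GRing.isLinear.Build k H H _ (lact f)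
  (sweedler_linear (lact_bilinear f)).

Lemma comul_sweedler x : comul H x = sweedler x (fun a b => a ⊗ b).
Proof. exact: tensor_sum_pure. Qed.

Lemma sweedler_ract (X : lmodType k) (h : H -> H -> X) f x : is_bilinear h ->
  sweedler (ract f x) h = sweedler x (fun a b => h a (ract f b)).
Proof.
move=> bh; have [hl hr] := bh.
pose lh a := linear_of (hr a).
pose L := linear_of (sweedler_linear bh).
rewrite -[LHS]/(L _) linear_sum.
transitivity (sweedler x (fun y c => sweedler y (fun a b => (f c : k) *: h a b))).
  apply: eq_bigr => p _; rewrite linearZ /=.
  by rewrite !sweedlerE scaler_sumr.
rewrite sweedler_coassoc.
- apply: eq_sweedler => a b; rewrite -[RHS]/(lh a _) /ract sweedler_comp.
  by apply: eq_sweedler => c d; rewrite linearZ.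
- by move=> b c a u v; rewrite hl scalerDr !scalerA mulrC.
- by move=> b c a u v; rewrite hr scalerDr !scalerA mulrC.
by move=> a b c u v; rewrite linearP scalerDl scalerA.
Qed.

Lemma sweedler_lact (X : lmodType k) (h : H -> H -> X) f x : is_bilinear h ->
  sweedler (lact f x) h = sweedler x (fun a b => h (lact f a) b).
Proof.
move=> bh; have [hl hr] := bh.
pose lh a := linear_of (hl a).
pose L := linear_of (sweedler_linear bh).
rewrite -[LHS]/(L _) linear_sum.
transitivity (sweedler x (fun c y => sweedler y (fun a b => (f c : k) *: h a b))).
  apply: eq_bigr => p _; rewrite linearZ /=.
  by rewrite !sweedlerE scaler_sumr.
rewrite -(sweedler_coassoc (f := fun c a b => (f c : k) *: h a b)).
- apply: eq_sweedler => a b; rewrite -[RHS]/(lh b _) /lact sweedler_comp.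
  by apply: eq_sweedler => c d; rewrite linearZ.
- by move=> b c a u v; rewrite linearP scalerDl scalerA.
- by move=> b c a u v; rewrite hl scalerDr !scalerA mulrC.
by move=> a b c u v; rewrite hr scalerDr !scalerA mulrC.
Qed.

Lemma ract_sum f x I (r : seq I) (u v : I -> H) :
  comul H x = \sum_(i <- r) u i ⊗ v i ->
  ract f x = \sum_(i <- r) (f (v i) : k) *: u i.
Proof. exact/sweedler_sum/ract_bilinear. Qed.

Lemma lact_sum f x I (r : seq I) (u v : I -> H) :
  comul H x = \sum_(i <- r) u i ⊗ v i ->
  lact f x = \sum_(i <- r) (f (u i) : k) *: v i.
Proof. exact/sweedler_sum/lact_bilinear. Qed.

Lemma counit_lact f x : counit H (lact f x) = f x.
Proof.
rewrite /lact sweedler_comp -[RHS](counit_sweedlerr x (linear_linear f)).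
by apply: eq_sweedler => a b; rewrite linearZ /= [LHS]mulrC.
Qed.

Lemma lact_counit x : lact (counit H) x = x. Proof. exact: counitl. Qed.
Lemma ract_counit x : ract (counit H) x = x. Proof. exact: counitr. Qed.

Lemma lact_ract f g x : lact f (ract g x) = ract g (lact f x).
Proof.
rewrite /lact sweedler_ract; last exact: lact_bilinear.
rewrite /lact sweedler_comp; by apply: eq_sweedler => a b; rewrite linearZ.
Qed.

Lemma comul_dual x n (u v : 'I_n -> H) (f g : 'I_n -> {linear H -> k^o}) :
    comul H x = \sum_i u i ⊗ v i -> dual_families u f -> dual_families v g ->
  (forall i, lact (f i) x = v i) /\ (forall i, ract (g i) x = u i).
Proof.
move=> cx fu gv; split=> i.
  rewrite (lact_sum _ cx) (bigD1 i) //= fu eqxx scale1r big1 ?addr0 //.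
  by move=> j ji; rewrite fu eq_sym (negPf ji) scale0r.
rewrite (ract_sum _ cx) (bigD1 i) //= gv eqxx scale1r big1 ?addr0 //.
by move=> j ji; rewrite gv eq_sym (negPf ji) scale0r.
Qed.

Lemma comul_minimal x : exists n (u v : 'I_n -> H)
  (f g : 'I_n -> {linear H -> k^o}),
  [/\ comul H x = \sum_i u i ⊗ v i, dual_families u f & dual_families v g].
Proof.
have sT : subspace [set: H] by [].
have [n [u [v [f [g [_ e fu gv]]]]]] :=
  tensor_minimal_expression (s := repr (comul H x)) sT sT (fun _ _ => conj I I).
by exists n, u, v, f, g; split; rewrite // -e -tensor_sum_pure.
Qed.

(** Entries of such an array span a subcoalgebra, and a convolution product
    evaluates on them as a matrix product, which turns convolution inverses into
    inverse matrices. *)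
Definition comatrix n (c : 'I_n -> 'I_n -> H) : Prop :=
  (forall i j, comul H (c i j) = \sum_l c i l ⊗ c l j) /\
  (forall i j, counit H (c i j) = (i == j)%:R).

(** The coefficients $f_i(x_1) x_2 g_j(x_3)$ of the finite-dimensional
    subcoalgebra generated by [x], where [f] and [g] are dual to the two families
    of factors of a shortest expression of the coproduct of [x]. *)
Lemma in_comatrix x : exists n (c : 'I_n -> 'I_n -> H) (a : 'I_n -> 'I_n -> k),
  comatrix c /\ x = \sum_i \sum_j a i j *: c i j.
Proof.
have [n [u [v [f [g [cx fu gv]]]]]] := comul_minimal x.
have [vE _] := comul_dual cx fu gv.
pose c i j := lact (f i) (u j).
have cv i : comul H (v i) = \sum_l c i l ⊗ v l.
  rewrite -vE comul_sweedler sweedler_lact; last exact: pure_tensor_bilinear.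
  apply: sweedler_sum cx.
  by apply: bilinear_of => a y z w; rewrite linearP /= ?pureDl ?pureZl.
have cE i j : c i j = ract (g j) (v i).
  rewrite (ract_sum _ (cv i)) (bigD1 j) //= gv eqxx scale1r big1 ?addr0 //.
  by move=> l lj; rewrite gv eq_sym (negPf lj) scale0r.
exists n, c, (fun i j => (counit H (u i) * counit H (v j) : k)).
split; first split=> i j.
- rewrite cE comul_sweedler sweedler_ract; last exact: pure_tensor_bilinear.
  have b : is_bilinear (fun a b : H => a ⊗ ract (g j) b).
    apply: bilinear_of => a y z w; first by rewrite pureDl pureZl.
    by rewrite !linearP.
  by rewrite (sweedler_sum b (cv i)); apply: eq_bigr => l _; rewrite -cE.
- by rewrite /c counit_lact fu.
rewrite -{1}(lact_counit x) (lact_sum _ cx); apply: eq_bigr => i _.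
rewrite -{1}(ract_counit (v i)) (ract_sum _ (cv i)) scaler_sumr.
by apply: eq_bigr => j _; rewrite scalerA.
Qed.

Definition perp (D : set H) (l : {linear H -> k^o}) := forall d, D d -> l d = 0.

(** The second condition expresses $\Delta(D) \subseteq D \otimes H$ by testing the
    left factor against the linear forms that vanish on [D]. *)
Definition right_coideal (D : set H) : Prop :=
  subspace D /\ forall l d, perp D l -> D d -> lact l d = 0.

End Actions.

(** * Extension of convolution-invertible maps to algebra maps *)

Section GeneratedSubalgebra.
Variables (k : fieldType) (F : comAlgType k) (S : set F).
Local Notation G := (generated_subalgebra S).

Lemma generated_is_subalgebra : is_subalgebra G.
Proof.
split=> [B [[] //]|a x y Gx Gy B sB|x y Gx Gy B sB].
  by case: (sB) => -[_ BL _] _; apply: BL; [exact: Gx|exact: Gy].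
by case: (sB) => -[_ _ BM] _; apply: BM; [exact: Gx|exact: Gy].
Qed.

Lemma generated_gen x : S x -> G x.
Proof. by move=> Sx B [_ SB]; exact: SB. Qed.

Lemma generated_ind (P : set F) : is_subalgebra P -> S `<=` P -> G `<=` P.
Proof. by move=> sP SP x; apply. Qed.

Definition genalg_pred : {pred F} := fun x => `[< G x >].
Record genalg := GenAlg { genalg_val :> F; genalgP : genalg_val \in genalg_pred }.

HB.instance Definition _ := [isSub for genalg_val].
HB.instance Definition _ := [Choice of genalg by <:].

Fact genalg_closed : subalg_closed genalg_pred.
Proof.
have [G1 GL GM] := generated_is_subalgebra.
split=> [|a x y /asboolP Gx /asboolP Gy|x y /asboolP Gx /asboolP Gy];
  apply/asboolP; [exact: G1|exact: GL|exact: GM].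
Qed.

HB.instance Definition _ :=
  GRing.isSubalgClosed.Build k F genalg_pred genalg_closed.
HB.instance Definition _ := [SubChoice_isSubComNzRing of genalg by <:].
HB.instance Definition _ := [SubZmodule_isSubLmodule of genalg by <:].
HB.instance Definition _ := [SubNzRing_SubLmodule_isSubLalgebra of genalg by <:].
HB.instance Definition _ := [SubLalgebra_isSubAlgebra of genalg by <:].

Definition in_genalg x (Gx : G x) : genalg := GenAlg (asboolT Gx).
Lemma genalg_in (a : genalg) : G (val a).
Proof. exact/asboolP/genalgP. Qed.

End GeneratedSubalgebra.

Section Extension.
Variables (k : fieldType) (H : hopfAlgebra k).

Section ComatrixValues.
Variables (R : comAlgType k) (n : nat) (c : 'I_n -> 'I_n -> H).
Hypothesis cc : comatrix c.

Definition comatrix_mx (f : H -> R) : 'M[R]_n := \matrix_(i, j) f (c i j).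

Lemma comatrix_mxM (f g : hom H R) :
  comatrix_mx (f * g) = comatrix_mx f *m comatrix_mx g.
Proof.
apply/matrixP=> i j; rewrite !mxE convE.
rewrite (sweedler_sum (conv_bilinear f g) (cc.1 i j)).
by apply: eq_bigr => l _; rewrite !mxE.
Qed.

Lemma comatrix_mx1 : comatrix_mx (1 : hom H R) = 1%:M.
Proof.
apply/matrixP=> i j; rewrite !mxE conv1E cc.2.
by case: (i == j); rewrite ?scale1r ?scale0r.
Qed.

Lemma comatrix_adj (f g : hom H R) i j : f * g = 1 ->
  \det (comatrix_mx f) * g (c i j) = (\adj (comatrix_mx f)) i j.
Proof.
move=> fg1.
have : \adj (comatrix_mx f) *m (comatrix_mx f *m comatrix_mx g) =
    \adj (comatrix_mx f) by rewrite -comatrix_mxM fg1 comatrix_mx1 mulmx1.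
rewrite mulmxA mul_adj_mx mul_scalar_mx => /matrixP/(_ i j) <-.
by rewrite !mxE.
Qed.

Lemma comatrix_det_unit (f g : hom H R) : f * g = 1 ->
  \det (comatrix_mx f) * \det (comatrix_mx g) = 1.
Proof. by move=> fg1; rewrite -det_mulmx -comatrix_mxM fg1 comatrix_mx1 det1. Qed.

End ComatrixValues.

Variables (Sym : comAlgType k) (t : {linear H -> Sym}).
Hypothesis hS : is_symmetric_algebra t.
Variables (F : fieldAlgType k) (phi : {lrmorphism Sym -> F}).
Hypothesis hF : is_field_of_fractions phi.
Variables (T T' : hom H F) (Q : comAlgType k) (tau tau' : hom H Q).
Hypothesis TE : forall x, T x = phi (t x).
Hypotheses (TT' : T * T' = 1) (tautau' : tau * tau' = 1).

(** The fractions [s / D] whose denominator becomes invertible under [theta],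
    paired with their images in [Q]. *)
Let graph (theta : {lrmorphism Sym -> Q}) (z : F) (w : Q) :=
  exists D s, [/\ phi D != 0, phi D * z = phi s,
    exists u, u * theta D = 1 & theta D * w = theta s].

(** Algebra maps out of the subalgebra generated by the values of [T] and [T'] are
    the convolution-invertible linear maps out of [H]: inverses of the values of
    [T] on a comatrix only require its determinant to become invertible, and that
    is automatic because a convolution inverse inverts the whole matrix. *)
Lemma extension : exists ev : {lrmorphism genalg (range T `|` range T') -> Q},
  (forall a x, val a = T x -> ev a = tau x) /\
  (forall a x, val a = T' x -> ev a = tau' x).
Proof.
have [theta [thetaE _]] := hS (tau : {linear H -> Q}).
pose G := graph theta; have [phi_inj _] := hF.
have Gfun z w w' : G z w -> G z w' -> w = w'.
  move=> [D [s [D0 Dz [u uD] Dw]]] [D' [s' [D'0 D'z [u' u'D] D'w]]].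
  have e : D' * s = D * s'.
    by apply: phi_inj; rewrite !rmorphM /= -Dz -D'z mulrCA.
  have : theta D' * (theta D * w) = theta D * (theta D' * w').
    by rewrite Dw D'w -!rmorphM e.
  rewrite [RHS]mulrCA => /(congr1 ( *%R (u' * u))).
  by rewrite !mulrA -[u' * u * _]mulrA [u * _]mulrC mulrA u'D mul1r uD !mul1r.
have GL a z w z' w' : G z w -> G z' w' -> G (a *: z + z') (a *: w + w').
  move=> [D [s [D0 Dz [u uD] Dw]]] [D' [s' [D'0 D'z [u' u'D] D'w]]].
  exists (D * D'), (a *: (D' * s) + D * s'); split.
  - by rewrite rmorphM mulf_neq0.
  - rewrite linearP /= !rmorphM /= -Dz -D'z mulrDr -scalerAr.
    by congr (_ *: _ + _); rewrite ?mulrA // -!mulrA mulrCA.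
  - by exists (u * u'); rewrite rmorphM mulrACA uD u'D mulr1.
  - rewrite linearP /= !rmorphM /= -Dw -D'w mulrDr -scalerAr.
    by congr (_ *: _ + _); rewrite ?mulrA // -!mulrA mulrCA.
have GM z w z' w' : G z w -> G z' w' -> G (z * z') (w * w').
  move=> [D [s [D0 Dz [u uD] Dw]]] [D' [s' [D'0 D'z [u' u'D] D'w]]].
  exists (D * D'), (s * s'); split.
  - by rewrite rmorphM mulf_neq0.
  - by rewrite !rmorphM /= -Dz -D'z mulrACA.
  - by exists (u * u'); rewrite rmorphM mulrACA uD u'D mulr1.
  - by rewrite !rmorphM /= -Dw -D'w mulrACA.
have Gphi s : G (phi s) (theta s).
  exists 1, s; rewrite !rmorph1 !mul1r oner_neq0; split=> //.
  by exists 1; rewrite mulr1.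
have GT x : G (T x) (tau x) by rewrite TE -thetaE.
have GT' x : G (T' x) (tau' x).
  (* The denominator is the determinant of the values of t on a comatrix, and the
     numerators are the entries of the adjugate. *)
  have [n [c [a [cc xE]]]] := in_comatrix x.
  pose M := comatrix_mx c t.
  have MF : map_mx phi M = comatrix_mx c T by apply/matrixP=> i j; rewrite !mxE TE.
  have MQ : map_mx theta M = comatrix_mx c tau.
    by apply/matrixP=> i j; rewrite !mxE thetaE.
  exists (\det M), (\sum_i \sum_j a i j *: (\adj M) i j).
  rewrite -!det_map_mx MF MQ; split.
  - apply/eqP => d0; have := comatrix_det_unit cc TT'.
    by rewrite d0 mul0r => /esym/eqP; rewrite oner_eq0.
  - rewrite xE !linear_sum mulr_sumr; apply: eq_bigr => i _.
    rewrite !linear_sum mulr_sumr; apply: eq_bigr => j _.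
    rewrite !linearZ -scalerAr (comatrix_adj cc) // -MF.
    by rewrite -map_mx_adj mxE.
  - by exists (\det (comatrix_mx c tau')); rewrite mulrC (comatrix_det_unit cc).
  - rewrite xE !linear_sum mulr_sumr; apply: eq_bigr => i _.
    rewrite !linear_sum mulr_sumr; apply: eq_bigr => j _.
    rewrite !linearZ -scalerAr (comatrix_adj cc) // -MQ.
    by rewrite -map_mx_adj mxE.
have Gtot z : generated_subalgebra (range T `|` range T') z -> exists w, G z w.
  move: z; apply: generated_ind.
    split=> [|a x y [w xw] [w' yw']|x y [w xw] [w' yw']].
    - by exists (theta 1); have := Gphi 1; rewrite rmorph1.
    - by exists (a *: w + w'); exact: GL.
    - by exists (w * w'); exact: GM.
  by move=> _ [[x _ <-]|[x _ <-]]; [exists (tau x)|exists (tau' x)].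
have [ev evP] := choice (fun a => Gtot _ (@genalg_in _ _ _ a)).
have evl : linear ev.
  by move=> a x y; apply: (Gfun _ _ _ (evP _)); apply: GL.
have evm : monoid_morphism ev.
  split=> [|x y]; last by apply: (Gfun _ _ _ (evP _)); apply: GM.
  by apply: (Gfun _ _ _ (evP _)); have := Gphi 1; rewrite !rmorph1.
pose ev' : {lrmorphism genalg (range T `|` range T') -> Q} := HB.pack ev
  (GRing.isLinear.Build k _ Q _ ev evl) (GRing.isMonoidMorphism.Build _ Q ev evm).
exists ev'; split=> a x ax.
  by apply: (Gfun _ _ _ (evP a)); rewrite ax.
by apply: (Gfun _ _ _ (evP a)); rewrite ax.
Qed.

End Extension.

(** * Bases obtained by climbing a tower of subspaces *)

Section Freeness.
Variables (k : fieldType) (V : lmodType k) (A : comAlgType k) (B : set A).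
Variable T : {linear V -> A}.
Hypothesis sB : is_subalgebra B.

Lemma subalgebra_subspace : subspace B.
Proof.
have [B1 BL BM] := sB; split=> //.
by rewrite -(addrN (1 : A)) addrC -scaleN1r; exact: BL.
Qed.

Inductive bspan (X : set V) : set A :=
| bspan0 : bspan X 0
| bspanS b x a : B b -> X x -> bspan X a -> bspan X (b * T x + a).

Lemma bspanD X a a' : bspan X a -> bspan X a' -> bspan X (a + a').
Proof.
elim=> [|b x c Bb Xx _ IH] Xa'; rewrite ?add0r // -addrA.
by apply: bspanS => //; exact: IH.
Qed.

Lemma bspanM X b a : B b -> bspan X a -> bspan X (b * a).
Proof.
move=> Bb; elim=> [|c x a' Bc Xx _ IH]; first by rewrite mulr0; exact: bspan0.
by rewrite mulrDr mulrA; apply: bspanS => //; case: sB => _ _; apply.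
Qed.

Lemma bspanZ X c a : bspan X a -> bspan X (c *: a).
Proof.
rewrite -mulr_algl; apply: bspanM; apply: subspaceZ; first exact: subalgebra_subspace.
by case: sB.
Qed.

Lemma bspan_subspace X : subspace (bspan X).
Proof.
split=> [|a x y Xx Xy]; first exact: bspan0.
by apply: bspanD => //; exact: bspanZ.
Qed.

Lemma bspan_elem X x : X x -> bspan X (T x).
Proof.
move=> Xx; rewrite -[T x]mul1r -[_ * _]addr0; apply: bspanS => //; last exact: bspan0.
by case: sB.
Qed.

Lemma bspan_sub X Y :
  (forall x, X x -> bspan Y (T x)) -> bspan X `<=` bspan Y.
Proof.
move=> XY a; elim=> [|b x c Bb /XY Yx _ IH]; first exact: bspan0.
by apply: bspanD IH; exact: bspanM.
Qed.

Lemma bspan_sum X (s : seq V) (c : V -> A) : (forall x, B (c x)) ->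
  (forall x, x \in s -> X x) -> bspan X (\sum_(x <- s) c x * T x).
Proof.
move=> Bc sX; rewrite big_seq; apply: (big_ind (bspan X)).
- exact: bspan0.
- exact: bspanD.
by move=> x /sX Xx; apply: bspanM => //; exact: bspan_elem.
Qed.

Definition independent (X : set V) := forall (s : seq V) (c : V -> A),
  uniq s -> (forall x, x \in s -> X x) -> (forall x, B (c x)) ->
  \sum_(x <- s) c x * T x = 0 -> forall x, x \in s -> c x = 0.

(** In a relation involving [x] the coefficient of $T(x)$ multiplies $T(x)$ into
    the span of [X], so it vanishes and the relation lies over [X]. *)
Lemma independent_adjoin X x : independent X ->
  (forall b, B b -> bspan X (b * T x) -> b = 0) -> independent (X `|` [set x]).
Proof.
move=> iX xX s c us sX Bc s0 y ys.
have [xs|xs] := boolP (x \in s); last first.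
  apply: (iX s) => // z zs; case: (sX _ zs) => // zx.
  by move: xs; rewrite -zx zs.
have srem z : z \in rem x s -> X z.
  rewrite mem_rem_uniq // !inE => /andP[zx zs]; case: (sX _ zs) => // /eqP.
  by rewrite (negPf zx).
move: s0; rewrite (perm_big _ (perm_to_rem xs)) big_cons /= => s0.
have cx0 : c x = 0.
  apply: xX => //; move/eqP: s0; rewrite addr_eq0 => /eqP ->.
  by rewrite -scaleN1r; apply/bspanZ/bspan_sum.
have [->//|yx] := eqVneq y x.
apply: (iX (rem x s) c); rewrite ?rem_uniq //; last by rewrite mem_rem_uniq // !inE yx.
by move: s0; rewrite cx0 mul0r add0r.
Qed.

(** Independence only involves finitely many vectors at a time, and finitely many
    vectors of the union of a chain already lie in one of its members. *)
Lemma finite_in_chain (I : Type) (C : set I) (X : I -> set V) (s : seq V) :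
  C !=set0 -> (forall i j, C i -> C j -> X i `<=` X j \/ X j `<=` X i) ->
  (forall x, x \in s -> exists2 i, C i & X i x) ->
  exists2 i, C i & forall x, x \in s -> X i x.
Proof.
move=> [i0 Ci0] Ctot; elim: s => [|y s IHs] sX; first by exists i0.
have [|i Ci iX] := IHs; first by move=> x xs; apply: sX; rewrite inE xs orbT.
have [|j Cj jy] := sX y; first by rewrite inE eqxx.
have [ij|ji] := Ctot _ _ Ci Cj.
  by exists j => // x; rewrite inE => /predU1P[->//|/iX/ij].
by exists i => // x; rewrite inE => /predU1P[->|/iX//]; exact: ji.
Qed.

(** Zorn's lemma for the pairs of a good subspace [D] and a set [X] whose image
    is a basis of the submodule generated by the image of [D]: one step adds to
    [D] a vector [x], and adds [x] to [X] only if [T x] is new; a new [T x]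
    generates a free summand by the last condition on [good]. *)
Lemma free_by_tower (good : set V -> Prop) :
    (forall D, good D -> subspace D) -> good [set 0] ->
    (forall C : set (set V), C !=set0 -> total_on C subset ->
       (forall D, C D -> good D) -> good (\bigcup_(D in C) D)) ->
    (forall D, good D -> D <> setT -> exists x, [/\ ~ D x, good (adjoin D x) &
       forall b, B b -> bspan D (b * T x) -> b = 0 \/ bspan D (T x)]) ->
    (forall a, bspan setT a) ->
  exists X, (forall a, bspan X a) /\ independent X.
Proof.
move=> good_sub good0 good_chain good_step spanT.
pose P (p : set V * set V) := [/\ good p.1, forall a, bspan p.1 a <-> bspan p.2 a
  & independent p.2].
pose R (p q : {p | P p}) := `[< (sval p).1 `<=` (sval q).1 /\
  (sval p).2 `<=` (sval q).2 >].
have P0 : P ([set 0], set0).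
  split=> //= [a|]; last by move=> s c _ sX _ _ y /sX.
  split; apply: bspan_sub => x; last by case.
  by move=> ->; rewrite linear0; exact: bspan0.
have [| | |] := @ZL_preorder {p | P p} (exist P _ P0) R.
- by move=> p; apply/asboolP; split.
- move=> q p r /asboolP[pq1 pq2] /asboolP[qr1 qr2]; apply/asboolP.
  by split=> x; [move/pq1/qr1|move/pq2/qr2].
- move=> C Ctot; have [->|/set0P C0] := eqVneq C set0; first by exists (exist P _ P0).
  pose D := \bigcup_(E in [set (sval p).1 | p in C]) E.
  pose X := \bigcup_(p in C) (sval p).2.
  have PU : P (D, X).
    split=> /=.
    - apply: good_chain.
      + by have [p Cp] := C0; exists (sval p).1, p.
      + move=> _ _ [p Cp <-] [q Cq <-].
        by have [/asboolP[]|/asboolP[]] := Ctot _ _ Cp Cq; [left|right].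
      + by move=> _ [p _ <-]; have [] := svalP p.
    - split; apply: bspan_sub => x.
        move=> [_ [p Cp <-] px]; have [_ pE _] := svalP p.
        have /pE := bspan_elem px; apply: bspan_sub => y py.
        by apply: bspan_elem; exists p.
      move=> [p Cp px]; have [_ pE _] := svalP p.
      have /pE := bspan_elem px; apply: bspan_sub => y py.
      by apply: bspan_elem; exists (sval p).1 => //; exists p.
    - move=> s c us sX.
      have [||p Cp ps] := @finite_in_chain _ C (fun p => (sval p).2) s C0.
      + move=> p q Cp Cq.
        by have [/asboolP[]|/asboolP[]] := Ctot _ _ Cp Cq; [left|right].
      + by move=> x /sX[p Cp px]; exists p.
      have [_ _ ip] := svalP p; exact: ip.
  exists (exist P _ PU) => p Cp; apply/asboolP; split=> x px /=.
    by exists (sval p).1 => //; exists p.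
  by exists p.
move=> -[[D X] /= PDX] Dmax; have [/= gD DX iX] := PDX.
suff DT : D = setT by exists X; split=> // a; apply/DX; rewrite DT.
apply: contrapT => /(good_step _ gD)[x [nDx gDx xD]].
have sD := good_sub _ gD.
suff [Y XY PY] : exists2 Y, X `<=` Y & P (adjoin D x, Y).
  apply: nDx; have /asboolP[/= + _] : R (exist P _ PY) (exist P _ PDX).
    apply: Dmax; apply/asboolP; split=> //=; exact: adjoin_sub.
  by apply; apply: adjoin_elem; case: sD.
have adjE Y : bspan Y (T x) -> (forall y, D y -> bspan Y (T y)) ->
    bspan (adjoin D x) `<=` bspan Y.
  move=> Yx DY; apply: bspan_sub => y [a Da].
  rewrite -[y](subrK (a *: x)) linearD [T (a *: x)]linearZ.
  by apply: bspanD; [exact: DY|exact: bspanZ].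
have [Dx|nx] := pselect (bspan D (T x)).
  exists X => //; split=> //= a; split.
    by apply: adjE => [|y Dy]; apply/DX => //; exact: bspan_elem.
  move=> /DX; apply: bspan_sub => y Dy; apply: bspan_elem; exact: adjoin_sub.
exists (X `|` [set x]) => [y|]; first by left.
split=> //= [a|].
  split.
    apply: adjE => [|y Dy]; first by apply: bspan_elem; right.
    have /DX := bspan_elem Dy; apply: bspan_sub => z Xz.
    by apply: bspan_elem; left.
  apply: bspan_sub => y [Xy|->]; last first.
    by apply/bspan_elem/adjoin_elem; case: sD.
  have /DX := bspan_elem Xy; apply: bspan_sub => z Dz.
  exact/bspan_elem/adjoin_sub.
by apply: independent_adjoin => // b Bb /DX/(xD _ Bb)[].
Qed.

Lemma bspan_expression X a : bspan X a -> exists (s : seq V) (c : V -> A),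
  [/\ uniq s, forall x, x \in s -> X x, forall x, B (c x)
    & a = \sum_(x <- s) c x * T x].
Proof.
have sBs := subalgebra_subspace.
elim=> [|b x c Bb Xx _ [s [e [us sX Be ->]]]].
  exists [::], (fun=> 0); rewrite big_nil; split=> // x; by case: sBs.
pose e' y := if y == x then b + (if x \in s then e x else 0) else e y.
have Be' y : B (e' y).
  rewrite /e'; case: ifP => // _; apply: subspaceD => //.
  by case: ifP => // _; case: sBs.
have e'E r : x \notin r -> \sum_(y <- r) e' y * T y = \sum_(y <- r) e y * T y.
  move=> xr; apply: eq_big_seq => y yr; rewrite /e'; case: eqP => // yx.
  by rewrite -yx yr in xr.
have [xs|xs] := boolP (x \in s).
  exists s, e'; split=> //; rewrite !(perm_big _ (perm_to_rem xs)) !big_cons /=.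
  rewrite e'E; last by rewrite mem_rem_uniq // !inE eqxx.
  by rewrite /e' eqxx xs mulrDl addrA.
exists (x :: s), e'; split=> //=; first by rewrite xs.
  by move=> y; rewrite inE => /predU1P[->//|/sX].
by rewrite big_cons e'E // /e' eqxx (negPf xs) addr0.
Qed.

End Freeness.

(** * The cocycle algebra and its span *)

Lemma conv_at1 (k : fieldType) (H : hopfAlgebra k) (R : algType k)
  (f g : hom H R) : (f * g) 1 = f 1 * g 1.
Proof. by rewrite convE sweedler1 //; exact: conv_bilinear. Qed.

(** In the convolution algebra of bilinear maps, $\sigma = (t \otimes t) * (t^{-1}
    \circ \mu)$, where $\mu$ is the product of [H], and $\sigma^{-1}$ is its inverse;
    this replaces computations with four-fold coproducts by cancellations in a
    monoid. *)
Section Cocycle.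
Variables (k : fieldType) (H : hopfAlgebra k) (R : comAlgType k).
Implicit Types T : hom H R.

Definition cocycle T T' : hom H (hom H R) := hleft T * hright T * hmul T'.
Definition cocycle_inv T T' : hom H (hom H R) :=
  hmul T * (hleft T' * hright T').

Lemma cocycleE T T' x y : cocycle T T' x y =
  sweedler x (fun a b => sweedler y (fun c d => T a * T c * T' (b * d))).
Proof.
rewrite conv2E; apply: eq_sweedler => a b; apply: eq_sweedler => c d.
by rewrite hleft_hright.
Qed.

Lemma cocycle_invE T T' x y : cocycle_inv T T' x y =
  sweedler x (fun a b => sweedler y (fun c d => T (a * c) * T' b * T' d)).
Proof.
rewrite conv2E; apply: eq_sweedler => a b; apply: eq_sweedler => c d.
by rewrite hleft_hright mulrA.
Qed.

Definition cocycle_alg T T' : set R := generated_subalgebra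
  ([set z | exists x y, z = cocycle T T' x y] `|`
   [set z | exists x y, z = cocycle_inv T T' x y]).

Lemma cocycle_in T T' x y : cocycle_alg T T' (cocycle T T' x y).
Proof. by apply: generated_gen; left; exists x, y. Qed.

Lemma cocycle_inv_in T T' x y : cocycle_alg T T' (cocycle_inv T T' x y).
Proof. by apply: generated_gen; right; exists x, y. Qed.

Lemma hmul_hright T T' x y :
  (hmul T * hright T') x y = sweedler y (fun c d => T (x * c) * T' d).
Proof.
rewrite conv2E /= -[RHS](@counit_sweedlerr _ _ _ x
  (fun z => sweedler y (fun c d => T (z * c) * T' d))).
  apply: eq_sweedler => a b; rewrite !sweedlerE scaler_sumr.
  by apply: eq_bigr => p _; rewrite -scalerAr.
move=> a u v; rewrite !sweedlerE scaler_sumr -big_split.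
by apply: eq_bigr => p _; rewrite /= mulrDl -scalerAl linearP mulrDl scalerAl.
Qed.

End Cocycle.

Section Spanning.
Variables (k : fieldType) (H : hopfAlgebra k) (A : comAlgType k).
Variables T T' : hom H A.
Hypothesis T'T : T' * T = 1.
Hypothesis A_gen : forall P : set A, is_subalgebra P ->
  (forall x, P (T x)) -> (forall x, P (T' x)) -> forall a, P a.
Local Notation B := (cocycle_alg T T').
Local Notation M := (bspan B T setT).

Let sB : is_subalgebra B. Proof. exact: generated_is_subalgebra. Qed.

Let T'1T1 : T' 1 * T 1 = 1.
Proof. by rewrite -conv_at1 T'T conv1E counit1 scale1r. Qed.

Let TT'1 : T 1 * T' 1 = 1.
Proof. by rewrite mulrC. Qed.

Let BT'1 : B (T' 1).
Proof.
suff <- : cocycle_inv T T' 1 1 = T' 1 by exact: cocycle_inv_in.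
by rewrite !conv_at1 /= counit1 !scale1r mulr1 mulrA TT'1 mul1r.
Qed.

Let M1 : M 1.
Proof. by rewrite -T'1T1; apply: bspanM => //; exact: bspan_elem. Qed.

Let M_TT x y : M (T x * T y).
Proof.
have <- : (cocycle T T' * hmul T) x y = T x * T y.
  by rewrite -mulrA -hmulM T'T hmul1 mulr1 hleft_hright.
rewrite conv2E; apply: subspace_sum => [|p]; first exact: bspan_subspace.
apply: subspace_sum => [|q]; first exact: bspan_subspace.
by apply: bspanM; [exact: sB|exact: cocycle_in|exact: bspan_elem].
Qed.

Let MM a b : M a -> M b -> M (a * b).
Proof.
have sM := bspan_subspace T sB setT.
elim=> [|c x a' Bc _ _ IHa] Mb; first by rewrite mul0r; case: sM.
rewrite mulrDl -mulrA; apply: bspanD; last exact: IHa.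
apply: bspanM => //; elim: Mb => [|d y b' Bd _ _ IHb].
  by rewrite mulr0; case: sM.
by rewrite mulrDr mulrCA; apply: bspanD IHb; exact: bspanM sB _ _ _ Bd (M_TT x y).
Qed.

(** Convolving the inverse cocycle with [T] in its first argument leaves
    $t_{x y_1} t^{-1}_{y_2}$; at $x \otimes y = S(z_1) \otimes z_2$ this becomes
    $t_1 t^{-1}_z$, which puts $t^{-1}_z$ in the span without any formula for the
    coproduct of an antipode. *)
Let M_T' z : M (T' z).
Proof.
have sM := bspan_subspace T sB setT.
have hE : hmul T * hright T' = cocycle_inv T T' * hleft T.
  rewrite /cocycle_inv hleft_hrightC; last exact: mulrC.
  by rewrite -!mulrA -hleftM T'T hleft1 mulr1.
have ME x y : M ((hmul T * hright T') x y).
  rewrite hE conv2E; apply: subspace_sum => // p; apply: subspace_sum => // q.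
  rewrite -scalerAr; apply: bspanZ => //.
  by apply: bspanM; [exact: sB|exact: cocycle_inv_in|exact: bspan_elem].
rewrite -[T' z]mul1r -T'1T1 -mulrA; apply: bspanM => //.
have <- : sweedler z (fun a b => (hmul T * hright T') (antipode H a) b) = T 1 * T' z.
  under eq_sweedler => a b do rewrite hmul_hright.
  rewrite -(sweedler_coassoc (f := fun a c d => T (antipode H a * c) * T' d)).
  - rewrite -[T' z](counit_sweedlerl z (hom_linear T')) sweedlerE mulr_sumr.
    apply: eq_bigr => p _; rewrite -scalerAr scalerAl -linearZ -antipodel.
    rewrite -/(sweedler _ _) sweedler_comp !sweedlerE mulr_suml.
    by [].
  - by move=> b c a u v; rewrite linearP mulrDl -scalerAl linearP mulrDl -scalerAl.
  - by move=> b c a u v; rewrite mulrDr -scalerAr linearP mulrDl -scalerAl.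
  by move=> a b c u v; rewrite linearP mulrDr -scalerAr.
by apply: subspace_sum => // p; exact: ME.
Qed.

(** The span of the image of [T] contains [T] and [T'], and it is closed under
    products because $t_x t_y = \sigma(x_1, y_1) t_{x_2 y_2}$. *)
Lemma cocycle_alg_span a : M a.
Proof.
apply: A_gen a => // [|x]; last exact: bspan_elem.
split=> // c x y Mx My.
by apply: subspaceD; [exact: bspan_subspace|exact: bspanZ|].
Qed.

End Spanning.

(** * Commutative Hopf algebras *)

Section CocycleFactorization.
Variables (k : fieldType) (H : hopfAlgebra k) (R : comAlgType k).
Implicit Types a b : hom H R.

Lemma cocycle_post (S : comAlgType k) (g : {lrmorphism R -> S}) T T' x y :
  g (cocycle T T' x y : R) = cocycle (post (H := H) g T) (post g T') x y.
Proof.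
rewrite !cocycleE sweedler_comp; apply: eq_sweedler => u v.
by rewrite sweedler_comp; apply: eq_sweedler => u' v'; rewrite !rmorphM.
Qed.

Lemma cocycle_inv_post (S : comAlgType k) (g : {lrmorphism R -> S}) T T' x y :
  g (cocycle_inv T T' x y : R) = cocycle_inv (post (H := H) g T) (post g T') x y.
Proof.
rewrite !cocycle_invE sweedler_comp; apply: eq_sweedler => u v.
by rewrite sweedler_comp; apply: eq_sweedler => u' v'; rewrite !rmorphM.
Qed.

(** Multiplicativity of $f \mapsto f \otimes f$: in a commutative [R] the values on
    the two arguments commute. *)
Lemma hleft_hright_conv a b :
  hleft (a * b) * hright (a * b) = hleft a * hright a * (hleft b * hright b).
Proof.
rewrite hleftM hrightM -!mulrA; congr (_ * _); rewrite !mulrA; congr (_ * _).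
by apply: hleft_hrightC; exact: mulrC.
Qed.

(** The second factor of a convolution product enters the cocycle only through
    its own cocycle. A multiplicative second factor therefore leaves the cocycle
    of the first one, and if everything commutes, the two cocycles multiply. *)
Lemma cocycle_factor a a' b b' : cocycle (a * b) (b' * a') =
  hleft a * hright a * cocycle b b' * hmul a'.
Proof. by rewrite /cocycle hleft_hright_conv hmulM !mulrA. Qed.

Lemma cocycle_inv_factor a a' b b' : cocycle_inv (a * b) (b' * a') =
  hmul a * cocycle_inv b b' * (hleft a' * hright a').
Proof. by rewrite /cocycle_inv hleft_hright_conv hmulM !mulrA. Qed.

Lemma cocycle_multiplicative b b' : b * b' = 1 ->
  (forall x y, b (x * y) = b x * b y) -> cocycle b b' = 1.
Proof.
move=> bb' bM; rewrite /cocycle.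
suff -> : hleft b * hright b = hmul b by rewrite -hmulM bb' hmul1.
by apply: hom2E => x y; rewrite hleft_hright /= bM.
Qed.

Lemma cocycle_inv_multiplicative b b' : b * b' = 1 ->
  (forall x y, b (x * y) = b x * b y) -> cocycle_inv b b' = 1.
Proof.
move=> bb' bM; rewrite /cocycle_inv.
suff -> : hmul b = hleft b * hright b.
  by rewrite -hleft_hright_conv bb' hleft1 hright1 mulr1.
by apply: hom2E => x y; rewrite hleft_hright /= bM.
Qed.

End CocycleFactorization.

(** [A] is the free commutative algebra on a convolution-invertible linear map
    out of [H]. *)
Definition universal_convolution_unit (k : fieldType) (H : hopfAlgebra k)
    (A : comAlgType k) (T T' : hom H A) : Prop :=
  forall (Q : comAlgType k) (tau tau' : hom H Q), tau * tau' = 1 ->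
  exists ev : {lrmorphism A -> Q},
    (forall x, ev (T x) = tau x) /\ (forall x, ev (T' x) = tau' x).

Section Twist.
Variables (k : fieldType) (H : hopfAlgebra k) (A C : comAlgType k).
Variables (T T' : hom H A) (chi chi' : hom H C).
Hypothesis T_univ : universal_convolution_unit T T'.
Hypotheses (TT' : T * T' = 1) (chichi' : chi * chi' = 1).

(** The translate $x \mapsto t_{x_1} \otimes \chi(x_2)$ of [T] by [chi]. With [chi] the
    identity of a commutative [H] it gives the coaction of [H] on [A]; with [chi]
    equal to [T] it gives the coproduct of [A]. *)
Definition twist : hom H (tensor A C) := post (tinl C) T * post (tinr A) chi.
Definition twist_inv : hom H (tensor A C) :=
  post (tinr A) chi' * post (tinl C) T'.

Lemma twistK : twist * twist_inv = 1.
Proof.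
rewrite /twist /twist_inv mulrA -[_ * _ * post _ chi']mulrA -postM chichi' post1.
by rewrite mulr1 -postM TT' post1.
Qed.

Lemma twistE x : twist x = sweedler x (fun a b => T a ⊗ chi b).
Proof.
by rewrite convE; apply: eq_sweedler => a b; rewrite !postE pureM mulr1 mul1r.
Qed.

Lemma twist_extension : exists ev : {lrmorphism A -> tensor A C},
  post ev T = twist /\ post ev T' = twist_inv.
Proof.
have [ev [evT evT']] := T_univ twistK.
by exists ev; split; apply: homE => x; [exact: evT|exact: evT'].
Qed.

End Twist.

Section LinearForms.
Variables (k : fieldType) (H : hopfAlgebra k) (A : comAlgType k).
Variable l : {linear H -> k^o}.

Fact scalar_form_linear : linear (fun x : H => (l x : k)%:A : A).
Proof. by move=> a x y; rewrite linearP scalerDl scalerA. Qed.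
Definition scalar_form : hom H A := hom_of scalar_form_linear.
End LinearForms.

Section Commutative.
Variables (k : fieldType) (H : hopfAlgebra k).
Hypothesis cH : commutative (@GRing.mul H).

Definition comhopf of commutative (@GRing.mul H) : Type := hopf_alg H.
HB.instance Definition _ := GRing.Algebra.on (comhopf cH).
HB.instance Definition _ := GRing.PzRing_hasCommutativeMul.Build (comhopf cH) cH.
Local Notation C := (comhopf cH).

Fact idC_linear : linear (fun x : H => x : C). Proof. by []. Qed.
Definition idC : hom H C := hom_of idC_linear.
Definition antipodeC : hom H C := 
  hom_of (linear_linear (antipode H) : linear (_ : H -> C)).

Lemma idC_inv : idC * antipodeC = 1.
Proof. by apply: homE => x; rewrite convE conv1E; exact: antipoder. Qed.

Variables (A : comAlgType k) (T T' : hom H A).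
Hypothesis T_univ : universal_convolution_unit T T'.
Hypothesis TT' : T * T' = 1.
Local Notation B := (cocycle_alg T T').

(** The algebra map $t_x \mapsto t_{x_1} \otimes x_2$ makes [A] an [H]-comodule
    algebra whose coinvariants contain [B]; untwisting by $t^{-1}$ recovers the
    coefficients of an element written on [T] over [B]. *)
Lemma coefficient_form (l : {linear H -> k^o}) :
  exists N : {linear A -> A}, forall b x, B b -> N (b * T x) = (l x : k) *: b.
Proof.
have [ev [evT evT']] := twist_extension T_univ TT' idC_inv.
have inrM x y : post (tinr A) idC (x * y) =
    post (tinr A) idC x * post (tinr A) idC y by rewrite !postE -rmorphM.
have inrV : post (tinr A) idC * post (tinr A) antipodeC = 1.
  by rewrite -postM idC_inv post1.
have evB : B `<=` [set b | ev b = tinl C b].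
  apply: generated_ind => [|_ [[x [y ->]]|[x [y ->]]]].
  - split=> /= [|a x y ex ey|x y ex ey]; first by rewrite !rmorph1.
      by rewrite !linearP /= ex ey.
    by rewrite !rmorphM /= ex ey.
  - rewrite /= !cocycle_post evT evT' cocycle_factor.
    by rewrite cocycle_multiplicative // mulr1.
  rewrite /= !cocycle_inv_post evT evT' cocycle_inv_factor.
  by rewrite cocycle_inv_multiplicative // mulr1.
pose g := T' * scalar_form A l.
have gb : is_bilinear (fun (a : A) (y : C) => a * g y).
  apply: bilinear_of => a u v w; first by rewrite mulrDl scalerAl.
  by rewrite linearP mulrDr scalerAr.
pose Psi := linear_of (tensor_lift_linear gb).
have Nl : linear (fun a => Psi (ev a)) by move=> a x y; rewrite !linearP.
exists (linear_of Nl) => b x Bb /=.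
rewrite rmorphM /= (evB _ Bb) -(postE ev) evT twistE.
transitivity (b * (T * g) x); last first.
  by rewrite /g mulrA TT' mul1r /= mulr_algr.
rewrite convE !sweedlerE !mulr_sumr.
rewrite -[LHS]/(Psi _) linear_sum; apply: eq_bigr => p _ /=.
by rewrite pureM mul1r tensor_lift_pure // mulrA.
Qed.

(** A linear form vanishing on [D] and equal to 1 at [x] yields a map on [A] that
    kills $B t_D$ and reads off [b] from $b t_x$. *)
Lemma commutative_step (D : set H) x b : subspace D -> ~ D x -> B b ->
  bspan B T D (b * T x) -> b = 0.
Proof.
move=> sD nDx Bb; have [l [lD lx]] := separation sD nDx.
have [N NE] := coefficient_form l => Jbx.
suff : N (b * T x) = 0 by rewrite NE // lx scale1r.
elim: Jbx => [|c d a Bc Dd _ IH]; first by rewrite linear0.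
by rewrite linearD NE // lD // scale0r add0r.
Qed.

End Commutative.

(** * Cocommutative Hopf algebras *)

Section TensorProductOfMaps.
Variables (k : fieldType) (A C Q : comAlgType k).
Variables (g : {lrmorphism A -> Q}) (h : {lrmorphism C -> Q}).

Fact tensor_mulmap_bilinear : is_bilinear (fun x y => g x * h y).
Proof.
apply: bilinear_of => a u v w; rewrite linearP ?mulrDl ?mulrDr.
  by rewrite -scalerAl.
by rewrite -scalerAr.
Qed.

Definition tensor_mulmap (z : tensor A C) : Q :=
  tensor_lift (fun x y => g x * h y) z.

Fact tensor_mulmap_linear : linear tensor_mulmap.
Proof. exact: (tensor_lift_linear tensor_mulmap_bilinear). Qed.
HB.instance Definition _ :=
  GRing.isLinear.Build k (tensor A C) Q _ tensor_mulmap tensor_mulmap_linear.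

Lemma tensor_mulmap_pure x y : tensor_mulmap (x ⊗ y) = g x * h y.
Proof. exact: (tensor_lift_pure tensor_mulmap_bilinear). Qed.

Fact tensor_mulmap_monoid : monoid_morphism tensor_mulmap.
Proof.
split=> [|z w]; first by rewrite -pure11 tensor_mulmap_pure !rmorph1 mulr1.
rewrite [z]tensor_sum_pure [w]tensor_sum_pure mulr_suml !linear_sum mulr_suml.
apply: eq_bigr => p _; rewrite !mulr_sumr linear_sum.
by apply: eq_bigr => q _; rewrite pureM /= !tensor_mulmap_pure !rmorphM mulrACA.
Qed.
HB.instance Definition _ := GRing.isMonoidMorphism.Build (tensor A C) Q
  tensor_mulmap tensor_mulmap_monoid.

End TensorProductOfMaps.

Section TensorOfSubalgebras.
Variables (k : fieldType) (A C : comAlgType k) (X : set A) (Y : set C).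

Definition tensor_in : set (tensor A C) := [set z | exists s : seq (A * C),
  (forall p, p \in s -> X p.1 /\ Y p.2) /\ z = \sum_(p <- s) p.1 ⊗ p.2].

Lemma tensor_in_pure x y : X x -> Y y -> tensor_in (x ⊗ y).
Proof.
move=> Xx Yy; exists [:: (x, y)]; rewrite big_seq1; split=> // p.
by rewrite inE => /eqP ->.
Qed.

Hypotheses (sX : is_subalgebra X) (sY : is_subalgebra Y).

Lemma tensor_in_subspace : subspace tensor_in.
Proof.
split=> [|a _ _ [s [sXY ->]] [r [rXY ->]]]; first by exists [::]; rewrite big_nil.
exists ([seq (a *: p.1, p.2) | p <- s] ++ r); split=> [p|].
  rewrite mem_cat => /orP[/mapP[q /sXY[Xq Yq] ->]|/rXY//]; split=> //=.
  exact: (subspaceZ _ (subalgebra_subspace sX)).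
rewrite big_cat big_map /= scaler_sumr; congr (_ + _).
by apply: eq_bigr => p _; rewrite pureZl.
Qed.

Lemma tensor_in_subalgebra : is_subalgebra tensor_in.
Proof.
have [X1 _ XM] := sX; have [Y1 _ YM] := sY; have [_ TL] := tensor_in_subspace.
split=> //; first exact: tensor_in_pure.
move=> _ _ [s [sXY ->]] [r [rXY ->]].
rewrite mulr_suml big_seq; apply: (big_ind tensor_in).
- by case: tensor_in_subspace.
- by move=> u v; apply: subspaceD; exact: tensor_in_subspace.
move=> p /sXY[Xp Yp]; rewrite mulr_sumr big_seq; apply: (big_ind tensor_in).
- by case: tensor_in_subspace.
- by move=> u v; apply: subspaceD; exact: tensor_in_subspace.
move=> q /rXY[Xq Yq]; rewrite pureM; apply: tensor_in_pure; [exact: XM|exact: YM].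
Qed.

End TensorOfSubalgebras.

Section Cocommutative.
Variables (k : fieldType) (H : hopfAlgebra k).
Hypothesis cH : cocommutative H.
Variables (A : comAlgType k) (T T' : hom H A).
Hypothesis T_univ : universal_convolution_unit T T'.
Hypotheses (TT' : T * T' = 1) (T'T : T' * T = 1).
Hypothesis A_gen : forall P : set A, is_subalgebra P ->
  (forall x, P (T x)) -> (forall x, P (T' x)) -> forall a, P a.
Local Notation B := (cocycle_alg T T').

Lemma convC (R : comAlgType k) : commutative (@GRing.mul (hom H R)).
Proof. by apply: conv_comm => //; exact: mulrC. Qed.

Lemma conv2C (R : comAlgType k) : commutative (@GRing.mul (hom H (hom H R))).
Proof. by apply: conv_comm => //; exact: convC. Qed.

Lemma cocycle_cocomm (R : comAlgType k) (a b a' b' : hom H R) :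
  cocycle (a * b) (b' * a') = cocycle a a' * cocycle b b'.
Proof. by rewrite cocycle_factor -mulrA [cocycle b b' * _]conv2C mulrA. Qed.

Lemma cocycle_inv_cocomm (R : comAlgType k) (a b a' b' : hom H R) :
  cocycle_inv (a * b) (b' * a') = cocycle_inv a a' * cocycle_inv b b'.
Proof. by rewrite cocycle_inv_factor -mulrA [cocycle_inv b b' * _]conv2C mulrA. Qed.

(** Exchanging $t$ and $t^{-1}$ exchanges $\sigma$ and $\sigma^{-1}$, so [B] is stable
    under the antipode of [A]. *)
Lemma cocycle_swap (R : comAlgType k) (a a' : hom H R) :
  cocycle a' a = cocycle_inv a a'.
Proof. by rewrite /cocycle_inv conv2C. Qed.

Lemma conv2_tensor (f g : hom H (hom H A)) (h : hom H (hom H (tensor A A))) x y :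
    (forall x y, B (f x y)) -> (forall x y, B (g x y)) ->
    (forall x y, h x y = sweedler x (fun a b => sweedler y (fun c d =>
       tinl A (f a c) * tinr A (g b d)))) ->
  tensor_in B B (h x y).
Proof.
move=> Bf Bg ->.
have sT : subspace (tensor_in B B).
  by apply: tensor_in_subspace; exact: generated_is_subalgebra.
apply: subspace_sum => // p; apply: subspace_sum => // q.
by rewrite pureM mulr1 mul1r; apply: tensor_in_pure.
Qed.

(** Under a translation $t_x \mapsto a(x_1) \otimes t_{x_2}$ the cocycle goes to
    $\sigma_a(x_1, y_1) \otimes \sigma(x_2, y_2)$, which has both factors in [B] if
    $\sigma_a$ takes values in [B]. *)
Lemma twist_cocycle_alg (ev : {lrmorphism A -> tensor A A}) (a a' : hom H A) :
    (forall x y, B (cocycle a a' x y)) ->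
    (forall x y, B (cocycle_inv a a' x y)) ->
    post ev T = post (tinl A) a * post (tinr A) T ->
    post ev T' = post (tinr A) T' * post (tinl A) a' ->
  forall b, B b -> tensor_in B B (ev b).
Proof.
move=> Ba Ba' evT evT'; apply: generated_ind => [|_ [[x [y ->]]|[x [y ->]]]].
- have sB := generated_is_subalgebra ([set z | exists x y, z = cocycle T T' x y]
    `|` [set z | exists x y, z = cocycle_inv T T' x y]).
  have [T1 TL TM] := tensor_in_subalgebra sB sB.
  split=> /= [|c x y Bx By|x y Bx By]; first by rewrite rmorph1.
    by rewrite linearP; exact: TL.
  by rewrite rmorphM; exact: TM.
- rewrite /= cocycle_post evT evT' cocycle_cocomm.
  apply: (@conv2_tensor (cocycle a a') (cocycle T T')) => //.
    by move=> *; exact: cocycle_in.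
  move=> {}x {}y; rewrite conv2E; apply: eq_sweedler => u v.
  apply: eq_sweedler => u' v'.
  by rewrite !cocycle_post.
rewrite /= cocycle_inv_post evT evT' cocycle_inv_cocomm.
apply: (@conv2_tensor (cocycle_inv a a') (cocycle_inv T T')) => //.
  by move=> *; exact: cocycle_inv_in.
move=> {}x {}y; rewrite conv2E; apply: eq_sweedler => u v.
  apply: eq_sweedler => u' v'.
by rewrite !cocycle_inv_post.
Qed.

(** [Delta] is the coproduct of [A] and [kappa] the map $a \mapsto S(a_1) \otimes a_2$;
    the last property is $a_1 S(a_2) \otimes a_3 = 1 \otimes a$. Both maps send [B] into
    $B \otimes B$, so [B] is a Hopf subalgebra. *)
Lemma comultiplication_maps : exists Delta kappa : {lrmorphism A -> tensor A A},
  [/\ forall x, Delta (T x) = sweedler x (fun a b => T a ⊗ T b),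
      forall b, B b -> tensor_in B B (Delta b),
      forall b, B b -> tensor_in B B (kappa b) &
      forall a, tensor_mulmap (tinl A) kappa (Delta a) = 1 ⊗ a].
Proof.
have [Delta [DT DT']] := twist_extension T_univ TT' TT'.
have [K [KT KT']] : exists K : {lrmorphism A -> tensor A A},
    post K T = twist T' T /\ post K T' = twist_inv T T'.
  have [K [KT KT']] := T_univ (twistK T'T TT').
  by exists K; split; apply: homE => x; [exact: KT|exact: KT'].
exists Delta, K; split.
- by move=> x; rewrite -(postE Delta) DT twistE.
- apply: twist_cocycle_alg DT DT' => x y; [exact: cocycle_in|exact: cocycle_inv_in].
- apply: twist_cocycle_alg KT KT' => x y; first by rewrite cocycle_swap; exact: cocycle_inv_in.
  by rewrite -cocycle_swap; exact: cocycle_in.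
pose mu : {lrmorphism tensor A A -> tensor A A} := tensor_mulmap (tinl A) K.
have mul a : mu (tinl A a) = tinl A a.
  by apply: (etrans (tensor_mulmap_pure _ _ a 1)); rewrite rmorph1 mulr1.
have mur a : mu (tinr A a) = K a.
  by apply: (etrans (tensor_mulmap_pure _ _ 1 a)); rewrite rmorph1 mul1r.
have post_l f : post (H := H) mu (post (tinl A) f) = post (tinl A) f.
  by apply: homE => x; rewrite !postE mul.
have post_r f : post (H := H) mu (post (tinr A) f) = post K f.
  by apply: homE => x; rewrite !postE mur.
have muT : post mu (post Delta T) = post (tinr A) T.
  rewrite DT /twist postM post_l post_r KT /twist mulrA -postM TT' post1.
  by rewrite mul1r.
have muT' : post mu (post Delta T') = post (tinr A) T'.
  rewrite DT' /twist_inv postM post_l post_r KT' /twist_inv -mulrA -postM TT'.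
  by rewrite post1 mulr1.
apply: A_gen => [|x|x].
- split=> /= [|c x y ex ey|x y ex ey]; first by rewrite !rmorph1.
    by rewrite !linearP /= ex ey.
  by rewrite !rmorphM /= ex ey pureM mulr1.
- exact: (congr1 (fun f : hom H _ => f x) muT).
exact: (congr1 (fun f : hom H _ => f x) muT').
Qed.

Fact slice_bilinear (l : {linear A -> k^o}) :
  is_bilinear (fun u v : A => (l u : k) *: v).
Proof.
apply: bilinear_of => a u v w; first by rewrite linearP scalerDl scalerA.
by rewrite scalerDr !scalerA mulrC.
Qed.

Definition slice (l : {linear A -> k^o}) (z : tensor A A) : A :=
  tensor_lift (fun u v => (l u : k) *: v) z.
HB.instance Definition _ l := GRing.isLinear.Build k (tensor A A) A _ (slice l)
  (tensor_lift_linear (slice_bilinear l)).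

Fact restrict_linear (l : {linear A -> k^o}) u : linear (fun y => l (u * T y)).
Proof. by move=> a x y; rewrite linearP mulrDr -scalerAr linearP. Qed.
Definition restrict l u := linear_of (restrict_linear l u).

Lemma slice_pure l u v : slice l (u ⊗ v) = (l u : k) *: v.
Proof. exact: (tensor_lift_pure (slice_bilinear l)). Qed.

(** A linear form on [A] that is evaluated on the first factor of
    $(u \otimes v)\Delta(t_y)$ acts on [y] through its restriction along $y \mapsto u t_y$. *)
Lemma slice_comul l u v y :
  slice l ((u ⊗ v) * sweedler y (fun a b => T a ⊗ T b)) =
  v * T (lact (restrict l u) y).
Proof.
rewrite !sweedlerE mulr_sumr linear_sum sweedler_comp mulr_sumr.
apply: eq_bigr => p _.
by rewrite pureM /= slice_pure linearZ -scalerAr.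
Qed.

(** If $b t_x$ lies in $J = B t_D$ then, [x] being a group-like direction modulo
    [D], the coproduct puts $b_1 t_x$ in [J] (tensored with $b_2$); multiplying by
    $S(b_2) \otimes b_3$ turns this into $t_x \otimes b \in J \otimes A$. *)
Lemma cocommutative_step (D : set H) x h b : right_coideal D -> T h * T' h = 1 ->
    (forall l, perp D l -> lact l x = (l x : k) *: h) ->
    B b -> bspan B T D (b * T x) ->
  b = 0 \/ bspan B T D (T x).
Proof.
move=> [sD Dco] hh xh Bb Jbx; set J := bspan B T D.
have sB : is_subalgebra B := generated_is_subalgebra _.
have sJ : subspace J := bspan_subspace T sB D.
have [Jx|nJx] := pselect (J (T x)); [by right|left].
have [Delta [kappa [DT DB KB DK]]] := comultiplication_maps.
have perp_restrict (l : {linear A -> k^o}) u :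
    (forall j, J j -> l j = 0) -> B u -> perp D (restrict l u).
  move=> lJ Bu d Dd; apply: lJ; apply: bspanM => //; exact: bspan_elem.
have J_slice (l : {linear A -> k^o}) j :
    (forall j, J j -> l j = 0) -> J j -> slice l (Delta j) = 0.
  move=> lJ; elim=> [|c d a Bc Dd _ IH]; first by rewrite !linear0.
  rewrite !linearD /= IH addr0 rmorphM /= DT; have [s [sB2 ->]] := DB _ Bc.
  rewrite mulr_suml linear_sum big_seq big1 // => p /sB2[Bp _].
  rewrite /= slice_comul Dco ?linear0 ?mulr0 //; exact: perp_restrict.
have [s [sB2 bE]] := DB _ Bb.
have [n [u [v [f [g [uvB sE fu gv]]]]]] :=
  tensor_minimal_expression (subalgebra_subspace sB) (subalgebra_subspace sB) sB2.
rewrite sE in bE.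
(* The second factors of the coproduct of b being independent, each first factor
   u i satisfies u i * T x \in J. *)
have Ju i : J (u i * T x).
  apply: contrapT => nJ; have [l [lJ lu]] := separation sJ nJ.
  have := J_slice l _ lJ Jbx; rewrite rmorphM /= DT bE mulr_suml linear_sum.
  under eq_bigr => j _.
    rewrite /= slice_comul xh; last exact: perp_restrict lJ (uvB j).1.
    rewrite linearZ -scalerAr /=. over.
  move=> /(congr1 ( *%R^~ (T' h))); rewrite mul0r mulr_suml.
  under eq_bigr => j _ do rewrite -scalerAl -mulrA hh mulr1.
  move=> /(congr1 (g i)); rewrite linear0 linear_sum (bigD1 i) //= linearZ /= gv.
  rewrite eqxx lu scale1r big1 ?addr0 => [/eqP|j ji]; first by rewrite oner_eq0.
  by rewrite linearZ /= gv eq_sym (negPf ji) scaler0.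
(* Expand T x ⊗ b through b_1 S(b_2) ⊗ b_3 and test the first factor against l. *)
have [l [lJ lx]] := separation sJ nJx.
have : slice l ((T x ⊗ 1) * (1 ⊗ b)) = b.
  by rewrite pureM mulr1 mul1r slice_pure lx scale1r.
move=> <-; rewrite -DK bE [tensor_mulmap _ _ _]linear_sum mulr_sumr linear_sum.
rewrite big1 // => i _.
rewrite /= tensor_mulmap_pure; have [r [rB ->]] := KB _ (uvB i).2.
rewrite [tinl A (u i) * _]mulr_sumr [(T x ⊗ 1) * _]mulr_sumr linear_sum.
rewrite big_seq big1 // => p /rB[Bp _].
rewrite !pureM /= slice_pure lJ ?scale0r //.
by rewrite mulrA mulrC [T x * _]mulrC; exact: bspanM sB _ _ _ Bp (Ju i).
Qed.

End Cocommutative.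

(** * Pointed cocommutative coalgebras *)

Section Pointed.
Variables (k : fieldType) (H : hopfAlgebra k).
Hypothesis cH : cocommutative H.
Implicit Types (D E : set H) (f l : {linear H -> k^o}).

Lemma lact_cocomm f x : lact f x = ract f x.
Proof. by rewrite /lact (sweedler_cocomm _ cH (lact_bilinear f)). Qed.

Lemma lact_adjoint f l x : l (ract f x) = f (lact l x).
Proof.
rewrite /ract /lact !sweedler_comp; apply: eq_sweedler => a b.
by rewrite !linearZ /= [LHS]mulrC.
Qed.

(** The submodule $D^\perp x$ over the convolution algebra of linear forms. *)
Definition orbit D x : set H := [set y | exists2 l, perp D l & y = lact l x].

Lemma orbit_subspace D x : subspace (orbit D x).
Proof.
split=> [|a _ _ [l lD ->] [l' l'D ->]].
  exists (linear_of (linear_linear (\0 : H -> k^o))) => //.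
  by rewrite /lact sweedlerE big1 // => p _; rewrite scale0r.
have cl : linear (fun y => a *: l y + l' y : k^o).
  move=> b y z; rewrite (linear_linear l) (linear_linear l') !scalerDr !scalerA.
  rewrite [b * a]mulrC.
  by rewrite addrACA.
exists (linear_of cl) => [d Dd|].
  by rewrite /= lD // l'D // scaler0 addr0.
rewrite /lact !sweedlerE scaler_sumr -big_split; apply: eq_bigr => p _.
by rewrite /= scalerDl scalerA.
Qed.

(** Linear forms commute under convolution, and $D^\perp$ is an ideal. *)
Lemma orbit_lact D x f y : right_coideal D -> orbit D x y -> orbit D x (lact f y).
Proof.
move=> [_ Dco] [l lD ->].
have cl : linear (fun y => l (ract f y)) by move=> a u v; rewrite !linearP.
exists (linear_of cl) => [d Dd|].
  by rewrite /= lact_adjoint Dco // linear0.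
rewrite [RHS]lact_cocomm lact_cocomm -lact_ract lact_cocomm.
by rewrite {1}/ract (sweedler_ract _ _ (ract_bilinear l)).
Qed.

(** In a shortest expression of the coproduct of [y], every factor is the result
    of acting on [y] by a linear form, by [comul_dual]. *)
Lemma stable_subcoalgebra E : subspace E ->
  (forall f y, E y -> E (lact f y)) -> is_subcoalgebra E.
Proof.
move=> sE Est; split=> // y Ey.
have [n [u [v [f [g [cy fu gv]]]]]] := comul_minimal y.
have [vE uE] := comul_dual cy fu gv.
exists [seq (u i, v i) | i <- index_enum 'I_n]; rewrite big_map; split=> // p.
move=> /mapP[i _ ->]; rewrite /= -vE -uE -lact_cocomm; split; exact: Est.
Qed.

(** A linear map killing a nonzero vector of a span makes one of the generators
    superfluous in the image. *)
Lemma span_eliminate (n : nat) (e : 'I_n.+1 -> H) (g : {linear H -> H}) y :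
    span e y -> y <> 0 -> g y = 0 ->
  exists e' : 'I_n -> H, forall z, span e z -> span e' (g z).
Proof.
move=> [b yE] y0 gy0.
have [j bj0] : exists j, b j != 0.
  apply: contrapT => nb; apply: y0; rewrite yE big1 // => i _.
  have [->|bi] := eqVneq (b i) 0; first by rewrite scale0r.
  by case: nb; exists i.
exists (fun i => g (e (lift j i))) => _ [a ->].
have gej : g (e j) = - \sum_i ((b j)^-1 * b (lift j i)) *: g (e (lift j i)).
  apply/eqP; rewrite -addr_eq0; apply/eqP.
  have := gy0; rewrite yE linear_sum (bigD1_ord j) //= => /(congr1 ( *:%R (b j)^-1)).
  rewrite scaler0 scalerDr linearZ scalerA mulVf // scale1r scaler_sumr => {2}<-.
  by congr (_ + _); apply: eq_bigr => i _; rewrite linearZ scalerA.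
exists (fun i => a (lift j i) - a j * ((b j)^-1 * b (lift j i))).
rewrite linear_sum (bigD1_ord j) //= linearZ /= gej scalerN scaler_sumr addrC -sumrB.
by apply: eq_bigr => i _; rewrite linearZ /= scalerBl scalerA.
Qed.

(** Let $D^\perp x$ be the space of all $l(x_1) x_2$ with $l$ vanishing on [D].
    If it needs as few generators as possible among [x] outside [D], then it is a
    simple subcoalgebra: acting by a linear form vanishing on a smaller nonzero
    subcoalgebra [E] produces another [x] outside [D] and kills [E]. *)
Lemma minimal_orbit D : right_coideal D -> D <> setT ->
  exists2 x, ~ D x & is_simple_subcoalgebra (orbit D x).
Proof.
move=> cD DT; have [sD Dco] := cD.
pose Q n := `[< exists2 x, ~ D x & exists e : 'I_n -> H, orbit D x `<=` span e >].
have exQ : exists n, Q n.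
  have [x nDx] : exists x, ~ D x.
    apply: contrapT => nx; apply: DT; apply/seteqP; split=> // x _.
    by apply: contrapT => nDx; apply: nx; exists x.
  have [n [u [v [_ [_ [cx _ _]]]]]] := comul_minimal x.
  exists n; apply/asboolP; exists x => //; exists v => _ [l _ ->].
  by rewrite (lact_sum _ cx); exists (fun i => l (u i)).
have [n /asboolP[x nDx [e xe]] nmin] := ex_minnP exQ.
exists x => //; have sO := orbit_subspace D x; split.
- by apply: stable_subcoalgebra => // f y; exact: orbit_lact.
- move=> O0; have [l [lD lx]] := separation sD nDx.
  have : orbit D x (lact l x) by exists l.
  rewrite O0 => /(congr1 (counit H)); rewrite counit_lact lx linear0 => /eqP.
  by rewrite oner_eq0.
move=> E [sE cE] EO; apply: contrapT => /not_orP[E0 EnO].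
have [y Ey y0] : exists2 y, E y & y <> 0.
  apply: contrapT => ny; apply: E0; apply/seteqP.
  split=> [y Ey|_ ->]; last by case: sE.
  by apply: contrapT => y0; apply: ny; exists y.
have [z Oz nEz] : exists2 z, orbit D x z & ~ E z.
  apply: contrapT => nz; apply: EnO; apply/seteqP; split=> // z Oz.
  by apply: contrapT => nEz; apply: nz; exists z.
have [f [fE fz]] := separation sE nEz.
have fy0 : ract f y = 0.
  have [s [sE2 cy]] := cE _ Ey; rewrite (ract_sum _ cy) big_seq big1 //.
  move=> p /sE2[_ Ep].
  by rewrite fE // scale0r.
case: n => [|n] in e xe nmin *.
  by have [a ya] := xe _ (EO _ Ey); apply: y0; rewrite ya big_ord0.
have [e' e'P] := span_eliminate (g := ract f) (xe _ (EO _ Ey)) y0 fy0.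
suff /nmin : Q n by rewrite ltnn.
apply/asboolP; exists (ract f x); last first.
  exists e' => _ [l lD ->]; rewrite lact_ract; apply/e'P/xe.
  by exists l.
move: Oz fz => [l lD ->]; rewrite -lact_adjoint => e1 /lD e0; move: e1.
by rewrite e0 => /eqP; rewrite eq_sym oner_eq0.
Qed.

(** The coproduct of [d] is a multiple of $d \otimes d$, and the counit axiom makes
    the factor the inverse of $\varepsilon(d)$; rescaling [d] by it gives a group-like
    element. *)
Lemma grouplike_of_line (d : H) : d <> 0 ->
    is_subcoalgebra [set a *: d | a in [set: k]] ->
  exists c : k, comul H (c *: d) = (c *: d) ⊗ (c *: d) /\ c * counit H d = 1.
Proof.
move=> d0 [_ cd].
have [c dd] : exists c : k, comul H d = c *: (d ⊗ d).
  have [|s [sd ->]] := cd d; first by exists 1 => //; rewrite scale1r.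
  rewrite big_seq; apply: (big_ind (fun z => exists c : k, z = c *: (d ⊗ d))).
  - by exists 0; rewrite scale0r.
  - by move=> _ _ [a ->] [b ->]; exists (a + b); rewrite scalerDl.
  move=> p /sd[[a _ <-] [b _ <-]]; exists (a * b).
  by rewrite pureZl pureZr scalerA.
have cd1 : c * counit H d = 1.
  have bl := lact_bilinear (counit H).
  have := counitl d; rewrite dd -pureZl tensor_lift_pure // linearZ /=.
  rewrite -[c *: _]/(c * counit H d) => e; apply/eqP; rewrite -subr_eq0.
  apply/eqP; apply: contrapT => /eqP ne.
  apply: d0; have : (c * counit H d - 1) *: d = 0 by rewrite scalerBl scale1r e subrr.
  move=> /(congr1 ( *:%R (c * counit H d - 1)^-1)).
  by rewrite scaler0 scalerA mulVf // scale1r.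
exists c; split=> //.
by rewrite linearZ /= dd pureZl pureZr.
Qed.

(** The line $D^\perp x$ of [minimal_orbit] is spanned by a group-like [h], and the
    counit identifies the coefficients: modulo [D], the coaction on [x] is
    $x \otimes h$. *)
Lemma pointed_step D : pointed H -> right_coideal D -> D <> setT -> exists x h,
  [/\ ~ D x, comul H h = h ⊗ h, counit H h = 1 &
      forall l, perp D l -> lact l x = (l x : k) *: h].
Proof.
move=> pH cD DT; have [x nDx sO] := minimal_orbit cD DT.
have [d [d0 OE]] := pH _ sO; have [cO _ _] := sO; rewrite OE in cO.
have [c [ch cd]] := grouplike_of_line d0 cO.
exists x, (c *: d); split=> // [|l lD]; first by rewrite linearZ.
have : orbit D x (lact l x) by exists l.
rewrite -(counit_lact l x) OE => -[a _ <-].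
rewrite [counit H _]linearZ scalerA /= -[a *: counit H d]/(a * counit H d).
by rewrite -mulrA [_ * c]mulrC cd mulr1.
Qed.

Lemma right_coideal_adjoin D x h : right_coideal D ->
  (forall l, perp D l -> lact l x = (l x : k) *: h) -> right_coideal (adjoin D x).
Proof.
move=> [sD Dco] xh; split=> [|l d lDx [a Dda]]; first exact: adjoin_subspace.
have lD : perp D l by move=> y Dy; apply: lDx; exact: adjoin_sub.
have lx : l x = 0 by apply/lDx/adjoin_elem; case: sD.
rewrite -[d](subrK (a *: x)) linearD /= Dco // add0r linearZ /=.
by rewrite xh // lx scale0r scaler0.
Qed.

End Pointed.

(** * Freeness *)

Section Chains.
Variables (k : fieldType) (H : hopfAlgebra k).

Lemma chain_subspace (V : lmodType k) (C : set (set V)) : C !=set0 ->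
  total_on C subset -> (forall D, C D -> subspace D) ->
  subspace (\bigcup_(D in C) D).
Proof.
move=> [D0 CD0] Ctot Csub; split; first by exists D0 => //; case: (Csub _ CD0).
move=> a x y [D CD Dx] [E CE Ey]; have [DE|ED] := Ctot _ _ CD CE.
  by exists E => //; apply: (Csub _ CE).2 => //; exact: DE.
by exists D => //; apply: (Csub _ CD).2 => //; exact: ED.
Qed.

Lemma zero_right_coideal : right_coideal (H := H) [set 0].
Proof. by split=> [|l d _ ->]; [exact: zero_subspace|rewrite linear0]. Qed.

Lemma chain_right_coideal (C : set (set H)) : C !=set0 -> total_on C subset ->
  (forall D, C D -> right_coideal D) -> right_coideal (\bigcup_(D in C) D).
Proof.
move=> C0 Ctot Cco; split; first by apply: chain_subspace => // D /Cco[].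
move=> l d lC [D CD Dd]; apply: (Cco _ CD).2 => // y Dy; apply: lC.
by exists D.
Qed.

End Chains.

(** The tower consists of all subspaces of [H] in the commutative case, and of the
    right coideals in the pointed cocommutative case. *)
Lemma universal_unit_free (k : fieldType) (H : hopfAlgebra k) (A : comAlgType k)
    (T T' : hom H A) : universal_convolution_unit T T' ->
    T * T' = 1 -> T' * T = 1 ->
    (forall P : set A, is_subalgebra P -> (forall x, P (T x)) ->
       (forall x, P (T' x)) -> forall a, P a) ->
    commutative (@GRing.mul H) \/ (pointed H /\ cocommutative H) ->
  exists X, (forall a, bspan (cocycle_alg T T') T X a) /\
    independent (cocycle_alg T T') T X.
Proof.
move=> univ TT' T'T gen hH; set B := cocycle_alg T T'.
have sB : is_subalgebra B := generated_is_subalgebra _.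
have span := cocycle_alg_span T'T gen.
case: hH => [cH|[pH cH]].
  apply: (free_by_tower sB (good := @subspace k H)) => //.
  - exact: zero_subspace.
  - exact: chain_subspace.
  move=> D sD DT; have [x nDx] : exists x, ~ D x.
    apply: contrapT => nx; apply: DT; apply/seteqP; split=> // x _.
    by apply: contrapT => nDx; apply: nx; exists x.
  exists x; split=> // [|b Bb bx]; first exact: adjoin_subspace.
  by left; exact: (commutative_step cH univ TT' sD nDx Bb bx).
apply: (free_by_tower sB (good := @right_coideal k H)) => //.
- by move=> D [].
- exact: zero_right_coideal.
- exact: chain_right_coideal.
move=> D cD DT; have [x [h [nDx ch eh xh]]] := pointed_step cH pH cD DT.
exists x; split=> // [|b Bb bx]; first exact: right_coideal_adjoin xh.
apply: (cocommutative_step cH univ TT' T'T gen cD _ xh Bb bx).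
have := congr1 (fun f : hom H A => f h) TT'.
rewrite convE conv1E /sweedler ch eh scale1r tensor_lift_pure //.
exact: conv_bilinear.
Qed.

(** The algebra maps above are defined on the type [genalg] of elements of
    $S(t_H)_\Theta$, whereas the theorem speaks of subsets of [F]; both descriptions
    of the coefficient algebra and of a basis are matched along the inclusion. *)
Section Transfer.
Variables (k : fieldType) (H : hopfAlgebra k) (F : fieldAlgType k).
Variables T T' : hom H F.
Local Notation A := (genalg (range T `|` range T')).

Fact genalg_left x : generated_subalgebra (range T `|` range T') (T x).
Proof. by apply: generated_gen; left; exists x. Qed.
Fact genalg_right x : generated_subalgebra (range T `|` range T') (T' x).
Proof. by apply: generated_gen; right; exists x. Qed.

Fact gen_unit_linear : linear (fun x => in_genalg (genalg_left x) : A).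
Proof. by move=> a x y; apply: val_inj; rewrite /= linearP. Qed.
Fact gen_inverse_linear : linear (fun x => in_genalg (genalg_right x) : A).
Proof. by move=> a x y; apply: val_inj; rewrite /= linearP. Qed.
Definition gen_unit : hom H A := hom_of gen_unit_linear.
Definition gen_inverse : hom H A := hom_of gen_inverse_linear.

Local Notation valA := (val : A -> F).

Lemma val_sweedler x (f : H -> H -> A) :
  valA (sweedler x f) = sweedler x (fun a b => valA (f a b)).
Proof. exact: raddf_sum. Qed.

Lemma gen_unitV : T * T' = 1 -> gen_unit * gen_inverse = 1.
Proof.
move=> TT'; apply: homE => x; apply: val_inj.
rewrite convE val_sweedler conv1E -[RHS]/((counit H x : k)%:A : F).
by rewrite -conv1E -TT' convE.
Qed.

Lemma gen_unitVl : T' * T = 1 -> gen_inverse * gen_unit = 1.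
Proof.
move=> TT'; apply: homE => x; apply: val_inj.
rewrite convE val_sweedler conv1E -[RHS]/((counit H x : k)%:A : F).
by rewrite -conv1E -TT' convE.
Qed.

Lemma gen_unit_ind (P : set A) : is_subalgebra P -> (forall x, P (gen_unit x)) ->
  (forall x, P (gen_inverse x)) -> forall a, P a.
Proof.
move=> [P1 PL PM] PT PT' a.
suff [a' /val_inj <-] : exists2 a' : A, valA a' = valA a & P a' by [].
have : generated_subalgebra (range T `|` range T') (valA a) := genalg_in a.
apply: (generated_ind (P := [set z | exists2 a' : A, valA a' = z & P a'])).
  split=> /= [|c _ _ [x <- Px] [y <- Py]|_ _ [x <- Px] [y <- Py]].
  - by exists 1.
  - by exists (c *: x + y) => //; exact: PL.
  - by exists (x * y) => //; exact: PM.
by move=> _ [[x _ <-]|[x _ <-]];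
  [exists (gen_unit x)|exists (gen_inverse x)].
Qed.

Lemma calB_lift z :
  calB T T' z <-> exists2 a, cocycle_alg gen_unit gen_inverse a & valA a = z.
Proof.
set B := cocycle_alg _ _.
have [B1 BL BM] : is_subalgebra B := generated_is_subalgebra _.
have val_cocycle x y : valA (cocycle gen_unit gen_inverse x y) = sigma T T' x y.
  rewrite cocycleE val_sweedler; apply: eq_sweedler => a b.
  by rewrite val_sweedler.
have val_cocycle_inv x y :
    valA (cocycle_inv gen_unit gen_inverse x y) = sigmainv T T' x y.
  rewrite cocycle_invE val_sweedler; apply: eq_sweedler => a b.
  by rewrite val_sweedler.
split.
  apply: (generated_ind (P := [set z | exists2 a, B a & valA a = z])).
    split=> /= [|c _ _ [x Bx <-] [y By <-]|_ _ [x Bx <-] [y By <-]].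
    - by exists 1.
    - by exists (c *: x + y) => //; exact: BL.
    - by exists (x * y) => //; exact: BM.
  move=> _ [[x [y ->]]|[x [y ->]]].
    by exists (cocycle gen_unit gen_inverse x y) => //; exact: cocycle_in.
  by exists (cocycle_inv gen_unit gen_inverse x y) => //; exact: cocycle_inv_in.
move=> [a + <-]; apply: (generated_ind (P := [set a | calB T T' (valA a)])).
  have [C1 CL CM] : is_subalgebra (calB T T') := generated_is_subalgebra _.
  by split=> /= [|c x y|x y]; [|exact: CL|exact: CM].
move=> _ [[x [y ->]]|[x [y ->]]] /=; apply: generated_gen.
  by left; exists x, y; exact: val_cocycle.
by right; exists x, y; exact: val_cocycle_inv.
Qed.

Lemma free_module_of_basis (X : set H) :
    (forall a, bspan (cocycle_alg gen_unit gen_inverse) gen_unit X a) ->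
    independent (cocycle_alg gen_unit gen_inverse) gen_unit X ->
  is_free_module (calB T T') (S_Theta T T').
Proof.
set B := cocycle_alg _ _ => spanX indX.
have sB : is_subalgebra B := generated_is_subalgebra _.
exists (set_type X), (fun i => T (val i)); split=> [i|z Sz|s c us Bc s0 i si].
- exact: genalg_left.
- have [s [c [us sX Bc sE]]] := bspan_expression sB (spanX (in_genalg Sz)).
  exists (pmap insub s), (fun i => valA (c (val i))); split.
    by move=> i; apply/calB_lift; exists (c (val i)); [exact: Bc|].
  have -> : z = valA (\sum_(x <- s) c x * gen_unit x) by rewrite -sE.
  rewrite (raddf_sum valA).
  have se : map val (pmap (insub : H -> option (set_type X)) s) = s.
    rewrite (pmap_filter (@insubK _ _ _)); apply/all_filterP/allP => x xs /=.
    by rewrite isSome_insub; apply/mem_set/sX.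
  by rewrite -[in LHS]se big_map.
have [cA cAP] := choice (P := fun i a => B a /\ valA a = c i) (fun i =>
  let: ex_intro2 a Ba ac := (calB_lift (c i)).1 (Bc i) in
  ex_intro _ a (conj Ba ac)).
pose c' x := if insub x is Some j then cA (j : set_type X) else 0.
have c'E (j : set_type X) : c' (val j) = cA j by rewrite /c' valK.
have c'0 : c' (val i) = 0.
  apply: (indX [seq val j | j <- s]).
  - by rewrite map_inj_uniq //; exact: val_inj.
  - by move=> _ /mapP[j _ ->]; exact/set_mem/valP.
  - move=> x; rewrite /c'; case: insubP => [j _ _|_]; first by case: (cAP j).
    by case: (subalgebra_subspace sB).
  - apply: val_inj; rewrite big_map (raddf_sum valA) -[RHS]s0.
    apply: eq_bigr => j _; rewrite c'E -[LHS]/(valA (cA j) * T (val j)).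
    by rewrite (cAP j).2.
  exact: map_f.
by rewrite -(cAP i).2 -c'E c'0.
Qed.

End Transfer.

Theorem theorem3p13 (k : fieldType) (H : hopfAlgebra k)
    (Sym : comAlgType k) (t : {linear H -> Sym}) (hS : is_symmetric_algebra t)
    (F : fieldAlgType k) (phi : {lrmorphism Sym -> F})
    (hF : is_field_of_fractions phi)
    (tinv : {linear H -> F}) (htinv : is_convolution_inverse (phi \o t) tinv)
    (hH : commutative (@GRing.mul H) \/ (pointed H /\ cocommutative H)) :
  is_free_module (calB (phi \o t) tinv) (S_Theta (phi \o t) tinv).
Proof.
have Tl : linear (phi \o t) by move=> a x y; rewrite /= !linearP.
pose T : hom H F := hom_of Tl.
pose T' : hom H F := hom_of (linear_linear tinv).
have TT' : T * T' = 1 by apply: homE => x; exact: (htinv x).1.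
have T'T : T' * T = 1 by apply: homE => x; exact: (htinv x).2.
suff [X [spanX indX]] : exists X,
    (forall a, bspan (cocycle_alg (gen_unit T T') (gen_inverse T T'))
       (gen_unit T T') X a) /\
    independent (cocycle_alg (gen_unit T T') (gen_inverse T T'))
      (gen_unit T T') X.
  exact: (free_module_of_basis spanX indX).
apply: universal_unit_free hH; first last.
- exact: gen_unit_ind.
- exact: gen_unitVl.
- exact: gen_unitV.
move=> Q tau tau' tt.
have [ev [evT evT']] := extension hS hF (fun x => erefl : T x = phi (t x)) TT' tt.
by exists ev; split=> x; [exact: evT|exact: evT'].
Qed.
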